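(* Let $\mathbf{N}$ be the normalization functor from simplicial abelian groups to non-negatively graded chain complexes of abelian groups, and let $\mathbf{K}$ be the functor from non-negatively graded chain complexes of abelian groups to simplicial abelian groups given by $\mathbf{K}_nA=\bigoplus_{i=0}^nA_i\otimes\Lambda^i\mathbb{Z}(n)$ with the simplicial structure described in the context. Then $\mathbf{K}\mathbf{N}\simeq 1$ on simplicial abelian groups and $\mathbf{N}\mathbf{K}\simeq 1$ on non-negatively graded chain complexes (isomorphisms of functors). Thus $\mathbf{K}$ is isomorphic to the classical adjoint inverse of the normalization functor.
   Context: $[n]=\{0,\dots,n\}$. $\mathbf{N}_mA=\bigcap_{i=0}^{m-1}\ker(d_i:A_m\to A_{m-1})$ with differential induced by $d_m$. Construction of $\mathbf{K}$. Let $\mathbb{Z}[n]$ be the free abelian group on $e_0,\dots,e_n$; a set map $\alpha:[m]\to[n]$ induces $\alpha:\mathbb{Z}[m]\to\mathbb{Z}[n]$, $e_i\mapsto e_{\alpha(i)}$. Put $v_i=e_i-e_n\in\mathbb{Z}[n]$ and let $\mathbb{Z}[[n]]\subseteq\mathbb{Z}[n]$ be the free subgroup on $v_0,\dots,v_{n-1}$; it is preserved: $\alpha(v_i)=v_{\alpha(i)}-v_{\alpha(m)}$ (with $v_n=0$). Let $\mathbb{Z}(n)=\mathrm{Hom}_{\mathbb{Z}}(\mathbb{Z}[[n]],\mathbb{Z})$, free on the dual basis $\varphi_0,\dots,\varphi_{n-1}$, $\varphi_j(v_i)=1$ if $i=j$ and $0$ otherwise. A map $\alpha:[m]\to[n]$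 acts contravariantly, $\alpha(\varphi)=\varphi\circ\alpha\in\mathbb{Z}(m)$ for $\varphi\in\mathbb{Z}(n)$, and this extends to a ring homomorphism $\alpha:\Lambda\mathbb{Z}(n)\to\Lambda\mathbb{Z}(m)$ of exterior algebras. Let $\delta_\alpha:\Lambda\mathbb{Z}(n)\to\Lambda\mathbb{Z}(m)$ be the $\alpha$-derivation of degree $-1$, i.e. the additive map with $\delta_\alpha(x\wedge y)=\delta_\alpha(x)\wedge\alpha(y)+(-1)^{|x|}\alpha(x)\wedge\delta_\alpha(y)$ for homogeneous $x,y$, determined by $\delta_\alpha(\varphi_i)=1$ if $i=\alpha(m)$ and $\delta_\alpha(\varphi_i)=0$ if $i\ne\alpha(m)$ ($0\le i\le n-1$). For a non-negatively graded chain complex $(A_*,d)$ of abelian groups, $\mathbf{K}_nA=\bigoplus_{i=0}^nA_i\otimes\Lambda^i\mathbb{Z}(n)$, and $\alpha:[m]\to[n]$ induces $\mathbf{K}(\alpha):\mathbf{K}_nA\to\mathbf{K}_mA$, $\mathbf{K}(\alpha)(a\otimes\varphi)=a\otimes\alpha(\varphi)+da\otimes\delta_\alpha(\varphi)$. Restricting to order-preserving $\alpha$ gives the simplicial structure. On chain maps $f$, $\mathbf{K}(f)(a\otimes\varphi)=f(a)\otimes\varphi$. *)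

(* Defs.v *)
From HB Require Import structures.
From mathcomp Require Import all_boot all_order all_algebra.
From mathcomp Require Import boolp zify.

Set Implicit Arguments.
Unset Strict Implicit.
Unset Printing Implicit Defensive.

Import GRing.Theory.

Local Open Scope ring_scope.
Local Open Scope quotient_scope.

(* Abelian groups are zmodTypes.  The choice structure they carry is no       *)
(* restriction, since boolp provides one on every type.                       *)

Record subgroup (V : zmodType) (S : zmodClosed V) :=
  Subgroup { subgroup_val : V; subgroup_valP : subgroup_val \in S }.

HB.instance Definition _ V S := [isSub for @subgroup_val V S].
HB.instance Definition _ V (S : zmodClosed V) := [Choice of subgroup S by <:].
HB.instance Definition _ V (S : zmodClosed V) :=
  [SubChoice_isSubZmodule of subgroup S by <:].

Section Restrict.
Variables (V W : zmodType) (S : zmodClosed V) (T : zmodClosed W).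
Variables (f : {additive V -> W}) (fST : forall x, x \in S -> f x \in T).

Definition restrict (x : subgroup S) : subgroup T :=
  Subgroup (fST (subgroup_valP x)).

Fact restrict_is_additive : zmod_morphism restrict.
Proof. by move=> x y; apply: val_inj; rewrite /= !raddfB. Qed.
HB.instance Definition _ :=
  GRing.isZmodMorphism.Build (subgroup S) (subgroup T) restrict
    restrict_is_additive.
End Restrict.

Definition homZ (U V : zmodType) := {additive U -> V}.

Lemma additiveP (U V : zmodType) (f g : {additive U -> V}) : f =1 g -> f = g.
Proof.
case: f g => [f [[fP]]] [g [[gP]]] /= /funext fg.
by case: _ / fg gP => gP; rewrite (Prop_irrelevance fP gP).
Qed.

Section HomZ.
Variables (U V : zmodType).
Implicit Types f g h : homZ U V.

HB.instance Definition _ := gen_eqMixin (homZ U V).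
HB.instance Definition _ := gen_choiceMixin (homZ U V).

Definition homZ_add f g : homZ U V :=
  (f : {additive U -> V}) \+ (g : {additive U -> V}).
Definition homZ_opp f : homZ U V := \- (f : {additive U -> V}).
Definition homZ_zero : homZ U V := \0 : {additive U -> V}.

Fact homZ_addA : associative homZ_add.
Proof. by move=> f g h; apply: additiveP => x /=; rewrite addrA. Qed.
Fact homZ_addC : commutative homZ_add.
Proof. by move=> f g; apply: additiveP => x /=; rewrite addrC. Qed.
Fact homZ_add0 : left_id homZ_zero homZ_add.
Proof. by move=> f; apply: additiveP => x /=; rewrite add0r. Qed.
Fact homZ_addN : left_inverse homZ_zero homZ_opp homZ_add.
Proof. by move=> f; apply: additiveP => x /=; rewrite addNr. Qed.
HB.instance Definition _ :=
  GRing.isZmodule.Build (homZ U V) homZ_addA homZ_addC homZ_add0 homZ_addN.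
End HomZ.

Definition homZ_fun (U V : zmodType) (f : homZ U V) : U -> V :=
  (f : {additive U -> V}).
Coercion homZ_fun : homZ >-> Funclass.

(* F 0 (+) ... (+) F n *)
Definition dsum (n : nat) (F : nat -> zmodType) := forall i : 'I_n.+1, F i.

Section DirectSum.
Variables (n : nat) (F : nat -> zmodType).
Implicit Types x y z : dsum n F.

HB.instance Definition _ := gen_eqMixin (dsum n F).
HB.instance Definition _ := gen_choiceMixin (dsum n F).

Definition dsum_add x y : dsum n F := fun i => x i + y i.
Definition dsum_opp x : dsum n F := fun i => - x i.
Definition dsum_zero : dsum n F := fun=> 0.

Fact dsum_addA : associative dsum_add.
Proof. by move=> x y z;
   apply/functional_extensionality_dep => i; apply: addrA. Qed.
Fact dsum_addC : commutative dsum_add.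
Proof. by move=> x y; apply/functional_extensionality_dep => i; apply: addrC. Qed.
Fact dsum_add0 : left_id dsum_zero dsum_add.
Proof. by move=> x; apply/functional_extensionality_dep => i; apply: add0r. Qed.
Fact dsum_addN : left_inverse dsum_zero dsum_opp dsum_add.
Proof. by move=> x; apply/functional_extensionality_dep => i; apply: addNr. Qed.
HB.instance Definition _ :=
  GRing.isZmodule.Build (dsum n F) dsum_addA dsum_addC dsum_add0 dsum_addN.

(* The component of degree i, read as 0 when i > n. *)
Definition dget (i : nat) (x : dsum n F) : F i :=
  match @idP (i < n.+1)%N with
  | ReflectT i_lt => x (Ordinal i_lt)
  | ReflectF _ => 0
  end.

Fact dget_is_additive i : zmod_morphism (dget i).
Proof. by rewrite /dget => x y /=; case: {-}_ / idP => // _; rewrite subr0. Qed.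
HB.instance Definition _ i :=
  GRing.isZmodMorphism.Build (dsum n F) (F i) (dget i) (dget_is_additive i).

Lemma dget_ord x (i : 'I_n.+1) : dget i x = x i.
Proof.
rewrite /dget; case: {-}_ / idP => [i_lt|/negP]; last by rewrite ltn_ord.
by case: i i_lt => i i_lt i_lt' /=; rewrite (bool_irrelevance i_lt' i_lt).
Qed.

Lemma dget_out x i : (n < i)%N -> dget i x = 0.
Proof. by rewrite /dget; case: {-}_ / idP => // i_lt; rewrite ltnNge -ltnS i_lt. Qed.

(* The inclusion of the summand of degree i, read as 0 when i > n. *)
Definition dput (i : nat) (a : F i) : dsum n F := fun j =>
  match @eqP nat i j with
  | ReflectT ij => eq_rect i F a j ij
  | ReflectF _ => 0
  end.

Lemma dget_put_eq i (a : F i) : (i <= n)%N -> dget i (dput a) = a.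
Proof.
rewrite -ltnS => i_lt; rewrite -[i in LHS]/(nat_of_ord (Ordinal i_lt)) dget_ord.
by rewrite /dput; case: eqP => // e; rewrite (eq_axiomK e).
Qed.

Lemma dget_put_neq i j (a : F i) : i != j -> dget j (dput a) = 0.
Proof.
move=> ij; have [j_le|] := leqP j n; last exact: dget_out.
rewrite -ltnS in j_le; rewrite -[j]/(nat_of_ord (Ordinal j_le)) dget_ord.
by rewrite /dput; case: eqP => // e; case/eqP: ij.
Qed.
End DirectSum.

(* The tensor product of abelian groups: the abelian group presented by the   *)
(* generators a (x) b subject to bilinearity.                                 *)

Inductive tterm (A B : Type) : Type :=
| TPure of A & B
| TZero
| TOpp of tterm A B
| TAdd of tterm A B & tterm A B.
Arguments TPure {A B}. Arguments TZero {A B}.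

HB.instance Definition _ A B := gen_eqMixin (tterm A B).
HB.instance Definition _ A B := gen_choiceMixin (tterm A B).

Inductive tcong (A B : zmodType) : tterm A B -> tterm A B -> Prop :=
| tcong_refl s : tcong s s
| tcong_sym s t : tcong s t -> tcong t s
| tcong_trans s t u : tcong s t -> tcong t u -> tcong s u
| tcong_opp s t : tcong s t -> tcong (TOpp s) (TOpp t)
| tcong_add s s' t t' :
    tcong s s' -> tcong t t' -> tcong (TAdd s t) (TAdd s' t')
| tcong_addA s t u : tcong (TAdd s (TAdd t u)) (TAdd (TAdd s t) u)
| tcong_addC s t : tcong (TAdd s t) (TAdd t s)
| tcong_add0 s : tcong (TAdd TZero s) s
| tcong_addN s : tcong (TAdd (TOpp s) s) TZero
| tcong_pureDl a a' b :
    tcong (TPure (a + a') b) (TAdd (TPure a b) (TPure a' b))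
| tcong_pureDr a b b' :
    tcong (TPure a (b + b')) (TAdd (TPure a b) (TPure a b')).

Section Tensor.
Variables (A B : zmodType).

Fact tequiv_refl : reflexive (fun s t : tterm A B => `[<tcong s t>]).
Proof. by move=> s; apply/asboolP; constructor. Qed.
Fact tequiv_sym : symmetric (fun s t : tterm A B => `[<tcong s t>]).
Proof. by move=> s t; apply: asbool_equiv_eq; split; apply: tcong_sym. Qed.
Fact tequiv_trans : transitive (fun s t : tterm A B => `[<tcong s t>]).
Proof.
move=> t s u /asboolP st /asboolP tu; apply/asboolP; exact: tcong_trans st tu.
Qed.
Canonical tequiv := EquivRel _ tequiv_refl tequiv_sym tequiv_trans.

Definition tensor := {eq_quot tequiv}.
HB.instance Definition _ := Choice.on tensor.
HB.instance Definition _ := EqQuotient.on tensor.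

Lemma tensorP s t : tcong s t <-> \pi_tensor s = \pi_tensor t.
Proof. by split=> [st|/eqquotP/asboolP//]; apply/eqquotP/asboolP. Qed.

Lemma tensor_repr s : tcong (repr (\pi_tensor s)) s.
Proof. by apply/tensorP; rewrite reprK. Qed.

Definition tens_zero : tensor := \pi_tensor TZero.
Definition tens_opp (x : tensor) : tensor := \pi_tensor (TOpp (repr x)).
Definition tens_add (x y : tensor) : tensor :=
  \pi_tensor (TAdd (repr x) (repr y)).

Lemma tens_oppE s : tens_opp (\pi_tensor s) = \pi_tensor (TOpp s).
Proof. by apply/tensorP; apply: tcong_opp (tensor_repr s). Qed.
Lemma tens_addE s t :
  tens_add (\pi_tensor s) (\pi_tensor t) = \pi_tensor (TAdd s t).
Proof. by apply/tensorP; apply: tcong_add; apply: tensor_repr. Qed.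

Fact tens_addA : associative tens_add.
Proof.
elim/quotW=> x; elim/quotW=> y; elim/quotW=> z.
by rewrite (tens_addE y z) (tens_addE x) (tens_addE x y) (tens_addE _ z);
   apply/tensorP; apply: tcong_addA.
Qed.
Fact tens_addC : commutative tens_add.
Proof.
elim/quotW=> x; elim/quotW=> y.
by rewrite (tens_addE x y) (tens_addE y x); apply/tensorP; apply: tcong_addC.
Qed.
Fact tens_add0 : left_id tens_zero tens_add.
Proof.
elim/quotW=> x.
by rewrite (tens_addE _ x); apply/tensorP; apply: tcong_add0.
Qed.
Fact tens_addN : left_inverse tens_zero tens_opp tens_add.
Proof.
elim/quotW=> x.
by rewrite (tens_oppE x) (tens_addE _ x); apply/tensorP; apply: tcong_addN.
Qed.
HB.instance Definition _ :=
  GRing.isZmodule.Build tensor tens_addA tens_addC tens_add0 tens_addN.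

Lemma tensor_subE s t :
  \pi_tensor s - \pi_tensor t = \pi_tensor (TAdd s (TOpp t)) :> tensor.
Proof. by rewrite -(tens_addE s) -(tens_oppE t). Qed.

Definition tpure (a : A) (b : B) : tensor := \pi_tensor (TPure a b).

Lemma tpureDl a a' b : tpure (a + a') b = tpure a b + tpure a' b.
Proof. by rewrite [RHS]tens_addE; apply/tensorP; apply: tcong_pureDl. Qed.
Lemma tpureDr a b b' : tpure a (b + b') = tpure a b + tpure a b'.
Proof. by rewrite [RHS]tens_addE; apply/tensorP; apply: tcong_pureDr. Qed.

Lemma tensor_ind (P : tensor -> Prop) :
    (forall a b, P (tpure a b)) -> P 0 -> (forall x, P x -> P (- x)) ->
  (forall x y, P x -> P y -> P (x + y)) -> forall x, P x.
Proof.
move=> Pp P0 PN PD x; rewrite -[x]reprK; elim: (repr x) => //= [s Ps|s Ps t Pt].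
  by rewrite -tens_oppE; apply: PN.
by rewrite -tens_addE; apply: PD.
Qed.

Section Lift.
Variables (V : zmodType) (f : A -> B -> V).
Hypothesis fDl : forall b, {morph f^~ b : a a' / a + a'}.
Hypothesis fDr : forall a, {morph f a : b b' / b + b'}.

Fixpoint teval (s : tterm A B) : V :=
  match s with
  | TPure a b => f a b
  | TZero => 0
  | TOpp s => - teval s
  | TAdd s t => teval s + teval t
  end.

Lemma teval_cong s t : tcong s t -> teval s = teval t.
Proof.
elim=> //=.
- by move=> ? ? ? _ -> _ ->.
- by move=> ? ? _ ->.
- by move=> ? ? ? ? _ -> _ ->.
- by move=> *; rewrite addrA.
- by move=> *; rewrite addrC.
- by move=> *; rewrite add0r.
- by move=> *; rewrite addNr.
- by move=> *; apply: fDl.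
Qed.

Definition tlift_fun of (forall b, {morph f^~ b : a a' / a + a'})
    & (forall a, {morph f a : b b' / b + b'}) :=
  fun x : tensor => teval (repr x).

Lemma tlift_pi s : tlift_fun fDl fDr (\pi_tensor s) = teval s.
Proof. exact/teval_cong/tensor_repr. Qed.

Fact tlift_is_additive : zmod_morphism (tlift_fun fDl fDr).
Proof.
elim/quotW=> s; elim/quotW=> t.
by rewrite tensor_subE !tlift_pi.
Qed.
HB.instance Definition _ :=
  GRing.isZmodMorphism.Build tensor V (tlift_fun fDl fDr) tlift_is_additive.

Definition tlift : {additive tensor -> V} := tlift_fun fDl fDr.

Lemma tlift_pure a b : tlift (tpure a b) = f a b.
Proof. exact: tlift_pi. Qed.
End Lift.

Lemma tensor_ext (V : zmodType) (f g : {additive tensor -> V}) :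
  (forall a b, f (tpure a b) = g (tpure a b)) -> f =1 g.
Proof.
move=> fg; elim/tensor_ind => // [|x|x y]; first by rewrite !raddf0.
  by rewrite !raddfN => ->.
by rewrite !raddfD => -> ->.
Qed.
End Tensor.

Section TensorMap.
Variables (A A' B B' : zmodType).
Variables (f : {additive A -> A'}) (g : {additive B -> B'}).

Fact tmapDl b : {morph (fun a b => tpure (f a) (g b))^~ b : a a' / a + a'}.
Proof. by move=> a a' /=; rewrite raddfD tpureDl. Qed.
Fact tmapDr a : {morph (fun a b => tpure (f a) (g b)) a : b b' / b + b'}.
Proof. by move=> b b' /=; rewrite raddfD tpureDr. Qed.

Definition tmap : {additive tensor A B -> tensor A' B'} := tlift tmapDl tmapDr.

Lemma tmap_pure a b : tmap (tpure a b) = tpure (f a) (g b).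
Proof. exact: tlift_pure. Qed.
End TensorMap.

(* The exterior algebra of an abelian group M: the ring presented by additive *)
(* generators m : M with m * m = 0.  The product of the ring is the wedge.    *)

Inductive eterm (M : Type) : Type :=
| EGen of M
| EZero
| EOne
| EOpp of eterm M
| EAdd of eterm M & eterm M
| EMul of eterm M & eterm M.
Arguments EZero {M}. Arguments EOne {M}.

HB.instance Definition _ M := gen_eqMixin (eterm M).
HB.instance Definition _ M := gen_choiceMixin (eterm M).

Inductive econg (M : zmodType) : eterm M -> eterm M -> Prop :=
| econg_refl s : econg s s
| econg_sym s t : econg s t -> econg t s
| econg_trans s t u : econg s t -> econg t u -> econg s u
| econg_opp s t : econg s t -> econg (EOpp s) (EOpp t)
| econg_add s s' t t' :
    econg s s' -> econg t t' -> econg (EAdd s t) (EAdd s' t')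
| econg_mul s s' t t' :
    econg s s' -> econg t t' -> econg (EMul s t) (EMul s' t')
| econg_addA s t u : econg (EAdd s (EAdd t u)) (EAdd (EAdd s t) u)
| econg_addC s t : econg (EAdd s t) (EAdd t s)
| econg_add0 s : econg (EAdd EZero s) s
| econg_addN s : econg (EAdd (EOpp s) s) EZero
| econg_mulA s t u : econg (EMul s (EMul t u)) (EMul (EMul s t) u)
| econg_mul1l s : econg (EMul EOne s) s
| econg_mul1r s : econg (EMul s EOne) s
| econg_mulDl s t u : econg (EMul (EAdd s t) u) (EAdd (EMul s u) (EMul t u))
| econg_mulDr s t u : econg (EMul s (EAdd t u)) (EAdd (EMul s t) (EMul s u))
| econg_genD m m' : econg (EGen (m + m')) (EAdd (EGen m) (EGen m'))
| econg_sqr m : econg (EMul (EGen m) (EGen m)) EZero.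

Section Exterior.
Variable M : zmodType.

Fact eequiv_refl : reflexive (fun s t : eterm M => `[<econg s t>]).
Proof. by move=> s; apply/asboolP; constructor. Qed.
Fact eequiv_sym : symmetric (fun s t : eterm M => `[<econg s t>]).
Proof. by move=> s t; apply: asbool_equiv_eq; split; apply: econg_sym. Qed.
Fact eequiv_trans : transitive (fun s t : eterm M => `[<econg s t>]).
Proof.
move=> t s u /asboolP st /asboolP tu; apply/asboolP; exact: econg_trans st tu.
Qed.
Canonical eequiv := EquivRel _ eequiv_refl eequiv_sym eequiv_trans.

Definition exterior := {eq_quot eequiv}.
HB.instance Definition _ := Choice.on exterior.
HB.instance Definition _ := EqQuotient.on exterior.

Lemma exteriorP s t : econg s t <-> \pi_exterior s = \pi_exterior t.
Proof. by split=> [st|/eqquotP/asboolP//]; apply/eqquotP/asboolP. Qed.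

Lemma exterior_repr s : econg (repr (\pi_exterior s)) s.
Proof. by apply/exteriorP; rewrite reprK. Qed.

Definition ext_zero : exterior := \pi_exterior EZero.
Definition ext_one : exterior := \pi_exterior EOne.
Definition ext_opp (x : exterior) : exterior := \pi_exterior (EOpp (repr x)).
Definition ext_add (x y : exterior) : exterior :=
  \pi_exterior (EAdd (repr x) (repr y)).
Definition ext_mul (x y : exterior) : exterior :=
  \pi_exterior (EMul (repr x) (repr y)).

Lemma ext_oppE s : ext_opp (\pi_exterior s) = \pi_exterior (EOpp s).
Proof. by apply/exteriorP; apply: econg_opp (exterior_repr s). Qed.
Lemma ext_addE s t :
  ext_add (\pi_exterior s) (\pi_exterior t) = \pi_exterior (EAdd s t).
Proof. by apply/exteriorP; apply: econg_add; apply: exterior_repr. Qed.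
Lemma ext_mulE s t :
  ext_mul (\pi_exterior s) (\pi_exterior t) = \pi_exterior (EMul s t).
Proof. by apply/exteriorP; apply: econg_mul; apply: exterior_repr. Qed.

Fact ext_addA : associative ext_add.
Proof.
elim/quotW=> x; elim/quotW=> y; elim/quotW=> z.
by rewrite (ext_addE y z) (ext_addE x) (ext_addE x y) (ext_addE _ z);
   apply/exteriorP; apply: econg_addA.
Qed.
Fact ext_addC : commutative ext_add.
Proof.
elim/quotW=> x; elim/quotW=> y.
by rewrite (ext_addE x y) (ext_addE y x); apply/exteriorP; apply: econg_addC.
Qed.
Fact ext_add0 : left_id ext_zero ext_add.
Proof.
elim/quotW=> x.
by rewrite (ext_addE _ x); apply/exteriorP; apply: econg_add0.
Qed.
Fact ext_addN : left_inverse ext_zero ext_opp ext_add.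
Proof.
elim/quotW=> x.
by rewrite (ext_oppE x) (ext_addE _ x); apply/exteriorP; apply: econg_addN.
Qed.
Fact ext_mulA : associative ext_mul.
Proof.
elim/quotW=> x; elim/quotW=> y; elim/quotW=> z.
by rewrite (ext_mulE y z) (ext_mulE x) (ext_mulE x y) (ext_mulE _ z);
   apply/exteriorP; apply: econg_mulA.
Qed.
Fact ext_mul1l : left_id ext_one ext_mul.
Proof.
elim/quotW=> x.
by rewrite (ext_mulE _ x); apply/exteriorP; apply: econg_mul1l.
Qed.
Fact ext_mul1r : right_id ext_one ext_mul.
Proof.
elim/quotW=> x.
by rewrite (ext_mulE x); apply/exteriorP; apply: econg_mul1r.
Qed.
Fact ext_mulDl : left_distributive ext_mul ext_add.
Proof.
elim/quotW=> x; elim/quotW=> y; elim/quotW=> z.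
by rewrite (ext_addE x y) (ext_mulE _ z) (ext_mulE x z) (ext_mulE y z)
  (ext_addE (EMul x z));
   apply/exteriorP; apply: econg_mulDl.
Qed.
Fact ext_mulDr : right_distributive ext_mul ext_add.
Proof.
elim/quotW=> x; elim/quotW=> y; elim/quotW=> z.
by rewrite (ext_addE y z) (ext_mulE x) (ext_mulE x y) (ext_mulE x z) (ext_addE
  (EMul x y));
   apply/exteriorP; apply: econg_mulDr.
Qed.
HB.instance Definition _ :=
  GRing.isZmodule.Build exterior ext_addA ext_addC ext_add0 ext_addN.
HB.instance Definition _ :=
  GRing.Zmodule_isPzRing.Build exterior
    ext_mulA ext_mul1l ext_mul1r ext_mulDl ext_mulDr.

Lemma exterior_subE s t :
  \pi_exterior s - \pi_exterior t = \pi_exterior (EAdd s (EOpp t)) :> exterior.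
Proof. by rewrite -(ext_addE s) -(ext_oppE t). Qed.
Lemma exterior_mulE s t :
  \pi_exterior s * \pi_exterior t = \pi_exterior (EMul s t) :> exterior.
Proof. exact: ext_mulE. Qed.

Definition epi (s : eterm M) : exterior := \pi_exterior s.

Lemma epi_eq s t : econg s t -> epi s = epi t.
Proof. by move=> st; apply/exteriorP. Qed.
Lemma epi_repr x : epi (repr x) = x.
Proof. exact: reprK. Qed.
Lemma epi1 : epi EOne = 1.
Proof. by []. Qed.
Lemma epiD s t : epi (EAdd s t) = epi s + epi t.
Proof. by rewrite -[LHS]ext_addE. Qed.
Lemma epiM s t : epi (EMul s t) = epi s * epi t.
Proof. by rewrite -[LHS]ext_mulE. Qed.

Definition egen (m : M) : exterior := \pi_exterior (EGen m).

Fact egenD : {morph egen : m m' / m + m'}.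
Proof. by move=> m m'; rewrite [RHS]ext_addE;
   apply/exteriorP; apply: econg_genD. Qed.
Fact egen_is_additive : zmod_morphism egen.
Proof. by move=> m m'; apply: (addIr (egen m')); rewrite -egenD !subrK. Qed.
HB.instance Definition _ :=
  GRing.isZmodMorphism.Build M exterior egen egen_is_additive.

Lemma egen_sqr m : egen m * egen m = 0.
Proof. by rewrite [LHS]ext_mulE; apply/exteriorP; apply: econg_sqr. Qed.

Lemma exterior_ind (P : exterior -> Prop) :
    (forall m, P (egen m)) -> P 0 -> P 1 -> (forall x, P x -> P (- x)) ->
    (forall x y, P x -> P y -> P (x + y)) ->
    (forall x y, P x -> P y -> P (x * y)) ->
  forall x, P x.
Proof.
move=> Pg P0 P1 PN PD PM x; rewrite -[x]reprK.
elim: (repr x) => //= [s Ps|s Ps t Pt|s Ps t Pt].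
- by rewrite -ext_oppE; apply: PN.
- by rewrite -ext_addE; apply: PD.
- by rewrite -ext_mulE; apply: PM.
Qed.

Section Lift.
Variables (R : pzRingType) (f : {additive M -> R}).
Hypothesis f_sqr : forall m, f m * f m = 0.

Fixpoint eeval (s : eterm M) : R :=
  match s with
  | EGen m => f m
  | EZero => 0
  | EOne => 1
  | EOpp s => - eeval s
  | EAdd s t => eeval s + eeval t
  | EMul s t => eeval s * eeval t
  end.

Lemma eeval_cong s t : econg s t -> eeval s = eeval t.
Proof.
elim=> //=.
- by move=> ? ? ? _ -> _ ->.
- by move=> ? ? _ ->.
- by move=> ? ? ? ? _ -> _ ->.
- by move=> ? ? ? ? _ -> _ ->.
- by move=> *; rewrite addrA.
- by move=> *; rewrite addrC.
- by move=> *; rewrite add0r.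
- by move=> *; rewrite addNr.
- by move=> *; rewrite mulrA.
- by move=> *; rewrite mul1r.
- by move=> *; rewrite mulr1.
- by move=> *; rewrite mulrDl.
- by move=> *; rewrite mulrDr.
- by move=> *; rewrite raddfD.
Qed.

Definition elift_fun of (forall m, f m * f m = 0) :=
  fun x : exterior => eeval (repr x).

Lemma elift_pi s : elift_fun f_sqr (\pi_exterior s) = eeval s.
Proof. exact/eeval_cong/exterior_repr. Qed.

Fact elift_is_additive : zmod_morphism (elift_fun f_sqr).
Proof.
elim/quotW=> s; elim/quotW=> t.
by rewrite exterior_subE !elift_pi.
Qed.
Fact elift_is_multiplicative : monoid_morphism (elift_fun f_sqr).
Proof.
split; first exact: elift_pi.
elim/quotW=> s; elim/quotW=> t.
by rewrite exterior_mulE !elift_pi.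
Qed.
HB.instance Definition _ :=
  GRing.isZmodMorphism.Build exterior R (elift_fun f_sqr) elift_is_additive.
HB.instance Definition _ :=
  GRing.isMonoidMorphism.Build exterior R (elift_fun f_sqr)
    elift_is_multiplicative.

Definition elift : {rmorphism exterior -> R} := elift_fun f_sqr.

Lemma elift_gen m : elift (egen m) = f m.
Proof. exact: elift_pi. Qed.
End Lift.

Lemma exterior_ext (R : pzRingType) (f g : {rmorphism exterior -> R}) :
  (forall m, f (egen m) = g (egen m)) -> f =1 g.
Proof.
move=> fg; elim/exterior_ind => // [|||x y|x y]; rewrite ?rmorph0 ?rmorph1 //.
- by move=> x; rewrite !rmorphN => ->.
- by rewrite !rmorphD => -> ->.
- by rewrite !rmorphM => -> ->.
Qed.

(* Lambda^i M: the additive span of the i-fold products of elements of M. *)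
Definition exterior_deg (i : nat) : {pred exterior} := fun x =>
  `[< exists s : seq (int * i.-tuple M),
      x = \sum_(t <- s) (\prod_(m <- t.2) egen m) *~ t.1 >].

Fact exterior_deg_zmod_closed i : zmod_closed (exterior_deg i).
Proof.
split=> [|x y /asboolP[s ->] /asboolP[t ->]]; apply/asboolP.
  by exists [::]; rewrite big_nil.
exists (s ++ [seq (- u.1, u.2) | u <- t]).
rewrite big_cat big_map /= -sumrN; congr (_ + _).
by apply: eq_bigr => u _; rewrite mulrNz.
Qed.
HB.instance Definition _ i :=
  GRing.isZmodClosed.Build exterior (exterior_deg i)
    (exterior_deg_zmod_closed i).

Lemma exterior_deg_prod i (t : i.-tuple M) :
  \prod_(m <- t) egen m \in exterior_deg i.
Proof. by apply/asboolP; exists [:: (1, t)]; rewrite big_seq1 mulr1z. Qed.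

Lemma exterior_deg_sub (V : zmodType) (S : zmodClosed V) i
    (f : {additive exterior -> V}) :
    (forall t : i.-tuple M, f (\prod_(m <- t) egen m) \in S) ->
  forall x, x \in exterior_deg i -> f x \in S.
Proof.
move=> fS x /asboolP[s ->]; rewrite raddf_sum rpred_sum // => t _.
by rewrite raddfMz rpredMz.
Qed.

Lemma exterior_deg_cons m i x :
  x \in exterior_deg i -> egen m * x \in exterior_deg i.+1.
Proof.
move=> /asboolP[s ->]; rewrite mulr_sumr rpred_sum // => -[c u] _ /=.
rewrite mulrzAr rpredMz //.
by have := exterior_deg_prod [tuple of m :: u]; rewrite big_cons.
Qed.
End Exterior.
Arguments exterior_deg : clear implicits.

Definition Lambda (M : zmodType) (i : nat) := subgroup (exterior_deg M i).

(* The grade involution, x |-> (-1)^i x on Lambda^i M. *)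
Section Sign.
Variable M : zmodType.

Fact esign_sqr m : (\- @egen M) m * (\- @egen M) m = 0.
Proof. by rewrite /= mulrNN egen_sqr. Qed.

Definition esign : {rmorphism exterior M -> exterior M} := elift esign_sqr.

Lemma esign_gen m : esign (egen m) = - egen m.
Proof. exact: elift_gen. Qed.

Lemma esign_deg i x : x \in exterior_deg M i -> esign x = (-1) ^+ i * x.
Proof.
move=> /asboolP[s ->]; rewrite rmorph_sum mulr_sumr; apply: eq_bigr => -[c t] _.
rewrite /= rmorphMz mulrzAr rmorph_prod; congr (_ *~ _).
rewrite -{2}(size_tuple t); elim: (t : seq M) => [|m u IH] /=.
  by rewrite !big_nil mulr1.
rewrite !big_cons IH exprS mulN1r !mulNr esign_gen mulNr; congr (- _).
by rewrite !mulrA; congr (_ * _); apply: commr_sign.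
Qed.
End Sign.

(* For g : M -> M' the induced ring morphism, and for l : M -> Z the unique   *)
(* g-derivation of degree -1 extending l.                                     *)

Section ExteriorMap.
Variables (M M' : zmodType) (g : {additive M -> M'}).

Fact emap_sqr m : (@egen M' \o g) m * (@egen M' \o g) m = 0.
Proof. exact: egen_sqr. Qed.

Definition emap : {rmorphism exterior M -> exterior M'} := elift emap_sqr.

Lemma emap_gen m : emap (egen m) = egen (g m).
Proof. exact: elift_gen. Qed.

Fact emap_deg_subproof i x :
  x \in exterior_deg M i -> emap x \in exterior_deg M' i.
Proof.
apply: exterior_deg_sub => t /=; rewrite rmorph_prod.
have -> : \prod_(m <- t) emap (egen m) = \prod_(m <- map_tuple g t) egen m.
  by rewrite big_map; apply: eq_bigr => m _; rewrite emap_gen.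
exact: exterior_deg_prod.
Qed.

Definition emap_deg i : {additive Lambda M i -> Lambda M' i} :=
  restrict (@emap_deg_subproof i).

Definition is_derivation (D : {additive exterior M -> exterior M'}) :=
  forall i x y, x \in exterior_deg M i ->
    D (x * y) = D x * emap y + (-1) ^+ i * emap x * D y.

Variable l : {additive M -> int}.

Fixpoint dereval (s : eterm M) : exterior M' :=
  match s with
  | EGen m => (l m)%:~R
  | EZero => 0
  | EOne => 0
  | EOpp s => - dereval s
  | EAdd s t => dereval s + dereval t
  | EMul s t => dereval s * emap (epi t) + esign M' (emap (epi s)) * dereval t
  end.

Lemma dereval_cong s t : econg s t -> dereval s = dereval t.
Proof.
elim=> //=.
- by move=> ? ? ? _ -> _ ->.
- by move=> ? ? _ ->.
- by move=> ? ? ? ? _ -> _ ->.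
- by move=> ? ? ? ? /epi_eq -> -> /epi_eq -> ->.
- by move=> *; rewrite addrA.
- by move=> *; rewrite addrC.
- by move=> *; rewrite add0r.
- by move=> *; rewrite addNr.
- move=> s' t' u; rewrite !epiM !rmorphM mulrDl mulrDr !mulrA.
  by rewrite -[RHS]addrA.
- by move=> s'; rewrite mul0r add0r epi1 !rmorph1 mul1r.
- by move=> s'; rewrite mulr0 addr0 epi1 !rmorph1 mulr1.
- by move=> *; rewrite epiD !rmorphD !mulrDl addrACA.
- by move=> *; rewrite epiD !rmorphD !mulrDr addrACA.
- by move=> m m'; rewrite raddfD rmorphD.
- move=> m; rewrite -[epi _]/(egen m) emap_gen esign_gen mulNr.
  by rewrite mulrzl mulrzr subrr.
Qed.

Definition ederiv_fun (x : exterior M) : exterior M' := dereval (repr x).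

Lemma ederiv_pi s : ederiv_fun (epi s) = dereval s.
Proof. exact/dereval_cong/exterior_repr. Qed.

Fact ederiv_is_additive : zmod_morphism ederiv_fun.
Proof.
by elim/quotW=> s; elim/quotW=> t; rewrite exterior_subE !ederiv_pi.
Qed.
HB.instance Definition _ :=
  GRing.isZmodMorphism.Build (exterior M) (exterior M') ederiv_fun
    ederiv_is_additive.

Definition ederiv : {additive exterior M -> exterior M'} := ederiv_fun.

Lemma ederiv_gen m : ederiv (egen m) = (l m)%:~R.
Proof. exact: ederiv_pi. Qed.
Lemma ederiv1 : ederiv 1 = 0.
Proof. exact: ederiv_pi. Qed.
Lemma ederivM x y :
  ederiv (x * y) = ederiv x * emap y + esign M' (emap x) * ederiv y.
Proof.
rewrite -(epi_repr x) -(epi_repr y) -[in LHS]epiM.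
by rewrite /= !ederiv_pi.
Qed.

Lemma ederiv_is_derivation : is_derivation ederiv.
Proof.
by move=> i x y xi; rewrite ederivM (esign_deg (emap_deg_subproof xi)).
Qed.

Lemma ederiv_unique (D : {additive exterior M -> exterior M'}) :
    is_derivation D -> (forall m, D (egen m) = (l m)%:~R) -> D =1 ederiv.
Proof.
move=> Dder Dgen.
have deg0_1 : 1 \in exterior_deg M 0.
  by have := exterior_deg_prod (nil_tuple M); rewrite big_nil.
have deg1_gen m : egen m \in exterior_deg M 1.
  by have := exterior_deg_prod [tuple m]; rewrite big_seq1.
have D1 : D 1 = 0.
  have := Dder 0%N 1 1 deg0_1; rewrite mulr1 rmorph1 !mulr1 expr0 mul1r => /eqP.
  by rewrite -[X in X == _]addr0 (can_eq (addKr _)) eq_sym => /eqP.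
suff DM x y : D y = ederiv y -> D (x * y) = ederiv (x * y).
  by move=> x; have := DM x 1; rewrite !mulr1; apply; rewrite D1 ederiv1.
elim/exterior_ind: x y => [m|||x IH|x z IHx IHz|x z IHx IHz] y Dy.
- by rewrite (Dder 1%N) // (@ederiv_is_derivation 1) // Dy Dgen ederiv_gen.
- by rewrite mul0r !raddf0.
- by rewrite mul1r.
- by rewrite mulNr !raddfN IH.
- by rewrite mulrDl !raddfD IHx // IHz.
- by rewrite -mulrA; apply/IHx/IHz.
Qed.

Fact ederiv_deg_subproof i x :
  x \in exterior_deg M i.+1 -> ederiv x \in exterior_deg M' i.
Proof.
apply: exterior_deg_sub; case/tupleP=> m t; rewrite /= big_cons.
have emapP j (u : j.-tuple M) :
    emap (\prod_(m <- u) egen m) \in exterior_deg M' j.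
  exact/emap_deg_subproof/exterior_deg_prod.
elim: i m t => [|i IH] m t.
  by rewrite tuple0 big_nil mulr1 ederiv_gen rpredMz //;
     have := exterior_deg_prod (nil_tuple M'); rewrite big_nil.
case/tupleP: t => m' t.
rewrite ederivM ederiv_gen emap_gen esign_gen mulrzl mulNr.
by rewrite rpredB ?rpredMz ?exterior_deg_cons // big_cons IH.
Qed.

Definition ederiv_deg i : {additive Lambda M i.+1 -> Lambda M' i} :=
  restrict (@ederiv_deg_subproof i).
End ExteriorMap.

Lemma emap_esign (M M' : zmodType) (g : {additive M -> M'}) x :
  emap g (esign M x) = esign M' (emap g x).
Proof.
apply: (exterior_ext (f := emap g \o esign M) (g := esign M' \o emap g)) => m.
by rewrite /= !(esign_gen, emap_gen) rmorphN emap_gen.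
Qed.

Lemma ederiv0 (M M' : zmodType) (k : {additive M -> M'}) (l : {additive M -> int}) :
  l =1 (fun=> 0) -> ederiv k l =1 (fun=> 0).
Proof.
move=> l0; elim/exterior_ind => [m|||x IH|x y IHx IHy|x y IHx IHy].
- by rewrite ederiv_gen l0.
- by rewrite raddf0.
- by rewrite ederiv1.
- by rewrite raddfN IH oppr0.
- by rewrite raddfD IHx IHy addr0.
- by rewrite ederivM IHx IHy mul0r mulr0 addr0.
Qed.

Section ExteriorFunctoriality.
Variables (M M' M'' : zmodType).
Variables (g : {additive M -> M'}) (h : {additive M' -> M''}).

Lemma emap_id (k : {additive M -> M}) : k =1 id -> emap k =1 id.
Proof.
by move=> k1; apply: (exterior_ext (g := idfun)) => m; rewrite emap_gen k1.
Qed.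

Lemma emap_comp (k : {additive M -> M''}) :
  k =1 h \o g -> emap k =1 emap h \o emap g.
Proof.
move=> kE; apply: (exterior_ext (g := emap h \o emap g)) => m /=.
by rewrite -/(emap k) !emap_gen kE.
Qed.

Lemma ederiv_comp (k : {additive M -> M''}) (l kl : {additive M -> int})
    (l' : {additive M' -> int}) :
    k =1 h \o g -> (forall m, kl m = l' (g m) + l m) ->
  forall x, ederiv k kl x = ederiv h l' (emap g x) + emap h (ederiv g l x).
Proof.
move=> kE klE; elim/exterior_ind => [m|||x IH|x y IHx IHy|x y IHx IHy].
- by rewrite emap_gen !ederiv_gen rmorph_int -rmorphD klE.
- by rewrite !raddf0 addr0.
- by rewrite rmorph1 !ederiv1 raddf0 addr0.
- by rewrite !raddfN IH opprD.
- by rewrite !raddfD IHx IHy addrACA.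
- rewrite rmorphM !ederivM IHx IHy !(emap_comp kE) rmorphD !rmorphM.
  by rewrite mulrDl mulrDr emap_esign addrACA.
Qed.
End ExteriorFunctoriality.

(* Lambda^i M vanishes in degrees above the number of generators of M. *)
Section ExteriorVanish.
Variables (M : zmodType) (n : nat) (b : 'I_n -> M).
Hypothesis b_gen : forall m, exists c : 'I_n -> int, m = \sum_(i < n) b i *~ c i.

Lemma egen_anticomm x y : egen x * egen y = - (egen y * egen x) :> exterior M.
Proof.
apply/eqP; rewrite -addr_eq0; have := egen_sqr (x + y).
by rewrite raddfD /= mulrDl !mulrDr !egen_sqr add0r addr0 => ->.
Qed.

Let word (w : seq 'I_n) : exterior M := \prod_(i <- w) egen (b i).

Lemma word_mem i w : i \in w -> egen (b i) * word w = 0.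
Proof.
elim: w => // j w IH; rewrite inE /word big_cons mulrA.
case: eqP => [<- _|_ /= /IH iw]; first by rewrite egen_sqr mul0r.
by rewrite egen_anticomm mulNr -mulrA [X in _ * X]iw mulr0 oppr0.
Qed.

Lemma word_not_uniq w : ~~ uniq w -> word w = 0.
Proof.
elim: w => //= i w IH; rewrite negb_and negbK /word big_cons.
by case/orP => [/word_mem//|/IH w0]; rewrite [X in _ * X]w0 mulr0.
Qed.

Lemma exterior_deg_gt i x : (n < i)%N -> x \in exterior_deg M i -> x = 0.
Proof.
have wordP (w : seq 'I_n) (t : seq M) : (n < size w + size t)%N ->
    word w * \prod_(m <- t) egen m = 0.
  elim: t w => [|m t IH] w sz.
    rewrite big_nil mulr1 word_not_uniq //; apply: contraL sz => /card_uniqP <-.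
    by rewrite addn0 -leqNgt -[X in (_ <= X)%N]card_ord max_card.
  have [c ->] := b_gen m; rewrite big_cons raddf_sum mulr_suml mulr_sumr.
  apply: big1 => j _; rewrite raddfMz mulrzAl mulrzAr mulrA.
  have := IH (rcons w j); rewrite size_rcons addSnnS => /(_ sz).
  by rewrite /word big_rcons => ->; rewrite mul0rz.
move=> lt_ni /asboolP[s ->]; apply: big1 => -[c t] _ /=.
have := wordP [::] t; rewrite /word big_nil mul1r size_tuple => -> //.
by rewrite mul0rz.
Qed.
End ExteriorVanish.

(* Z[n], its subgroup Z[[n]] and the dual group Z(n), for [n] = {0, ..., n}.  *)

Definition Zfree (n : nat) := {ffun 'I_n.+1 -> int}.
HB.instance Definition _ n := GRing.Zmodule.on (Zfree n).

Definition Zbase n (i : 'I_n.+1) : Zfree n := [ffun j => (j == i)%:R].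

Lemma Zfree_sum n (x : Zfree n) : x = \sum_i Zbase i *~ x i.
Proof.
apply/ffunP => j; rewrite sum_ffunE (bigD1 j) //= big1 ?addr0 => [|i ij].
  by rewrite ffunMzE ffunE eqxx mulrzz mul1r.
by rewrite ffunMzE ffunE eq_sym (negPf ij) mul0rz.
Qed.

Lemma Zfree_ext n (V : zmodType) (f g : {additive Zfree n -> V}) :
  (forall i, f (Zbase i) = g (Zbase i)) -> f =1 g.
Proof.
move=> fg x; rewrite [x]Zfree_sum !raddf_sum; apply: eq_bigr => i _.
by rewrite !raddfMz /= fg.
Qed.

Section Zmap.
Variables (m n : nat) (a : {ffun 'I_m.+1 -> 'I_n.+1}).

Definition Zmap_fun (x : Zfree m) : Zfree n := \sum_i Zbase (a i) *~ x i.

Fact Zmap_is_additive : zmod_morphism Zmap_fun.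
Proof.
move=> x y; rewrite -sumrB; apply: eq_bigr => i _.
by rewrite !ffunE mulrzBr.
Qed.
HB.instance Definition _ :=
  GRing.isZmodMorphism.Build (Zfree m) (Zfree n) Zmap_fun Zmap_is_additive.

Definition Zmap : {additive Zfree m -> Zfree n} := Zmap_fun.

Lemma Zmap_base i : Zmap (Zbase i) = Zbase (a i).
Proof.
rewrite /= /Zmap_fun (bigD1 i) //= big1 ?addr0 => [|j ji].
  by rewrite ffunE eqxx mulr1z.
by rewrite ffunE (negPf ji) mulr0z.
Qed.
End Zmap.

(* v_i = e_i - e_n; in particular v_n = 0. *)
Definition Zvec_val n (i : 'I_n.+1) : Zfree n := Zbase i - Zbase ord_max.

Definition Zred_pred (n : nat) : {pred Zfree n} := fun x =>
  `[< exists c : 'I_n -> int,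
      x = \sum_(i < n) Zvec_val (widen_ord (leqnSn n) i) *~ c i >].

Fact Zred_zmod_closed n : zmod_closed (@Zred_pred n).
Proof.
split=> [|x y /asboolP[c ->] /asboolP[d ->]]; apply/asboolP.
  by exists (fun=> 0); rewrite big1.
exists (fun i => c i - d i); rewrite -sumrB; apply: eq_bigr => i _.
by rewrite mulrzBr.
Qed.
HB.instance Definition _ n :=
  GRing.isZmodClosed.Build (Zfree n) (@Zred_pred n) (@Zred_zmod_closed n).

(* Z[[n]] *)
Definition Zred (n : nat) := subgroup (@Zred_pred n).
HB.instance Definition _ n := GRing.Zmodule.on (Zred n).

Fact Zvec_subproof n (i : 'I_n.+1) : Zvec_val i \in @Zred_pred n.
Proof.
have [i_lt|n_le] := ltnP i n; last first.
  have -> : i = ord_max by apply/val_inj/eqP; rewrite eqn_leq -ltnS ltn_ord.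
  by rewrite /Zvec_val subrr rpred0.
apply/asboolP; exists (fun j => (j == Ordinal i_lt)%:R).
rewrite (bigD1 (Ordinal i_lt)) //= big1 ?addr0 => [|j /negPf->]; last first.
  by rewrite mulr0z.
by rewrite eqxx mulr1z; congr Zvec_val; apply: val_inj.
Qed.

Definition Zvec n (i : 'I_n.+1) : Zred n := Subgroup (Zvec_subproof i).

Lemma Zvec_max n : Zvec (@ord_max n) = 0.
Proof. by apply: val_inj; rewrite /= /Zvec_val subrr. Qed.

Lemma Zred_sum n (x : Zred n) : exists c : 'I_n -> int,
  x = \sum_(i < n) Zvec (widen_ord (leqnSn n) i) *~ c i.
Proof.
have /asboolP[c xE] := subgroup_valP x; exists c; apply: val_inj.
rewrite [RHS]raddf_sum [LHS]xE; apply: eq_bigr => i _.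
by rewrite raddfMz.
Qed.

Lemma Zred_ext n (V : zmodType) (f g : {additive Zred n -> V}) :
  (forall i, f (Zvec i) = g (Zvec i)) -> f =1 g.
Proof.
move=> fg x; have [c ->] := Zred_sum x; rewrite !raddf_sum.
by apply: eq_bigr => i _; rewrite !raddfMz /= fg.
Qed.

Section Zred_map.
Variables (m n : nat) (a : {ffun 'I_m.+1 -> 'I_n.+1}).

Lemma Zmap_vec_val i :
  Zmap a (Zvec_val i) = Zvec_val (a i) - Zvec_val (a ord_max).
Proof. by rewrite raddfB !Zmap_base opprB addrA subrK. Qed.

Fact Zred_map_subproof x :
  x \in @Zred_pred m -> Zmap a x \in @Zred_pred n.
Proof.
move=> /asboolP[c ->]; rewrite raddf_sum rpred_sum // => i _.
by rewrite raddfMz rpredMz // Zmap_vec_val rpredB // Zvec_subproof.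
Qed.

Definition Zred_map : {additive Zred m -> Zred n} :=
  restrict Zred_map_subproof.

Lemma Zred_map_vec i : Zred_map (Zvec i) = Zvec (a i) - Zvec (a ord_max).
Proof. by apply: val_inj; rewrite [LHS]Zmap_vec_val. Qed.
End Zred_map.

(* Z(n) = Hom(Z[[n]], Z) *)
Definition Zdual (n : nat) := homZ (Zred n) int.
HB.instance Definition _ n := GRing.Zmodule.on (Zdual n).

Section Zdual.
Variable n : nat.

Definition Zeval_fun (x : Zred n) (f : Zdual n) : int := f x.
Fact Zeval_is_additive x : zmod_morphism (Zeval_fun x).
Proof. by []. Qed.
HB.instance Definition _ x :=
  GRing.isZmodMorphism.Build (Zdual n) int (Zeval_fun x) (Zeval_is_additive x).
Definition Zeval x : {additive Zdual n -> int} := Zeval_fun x.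
(* The dual basis phi_i : v_j |-> (i == j), for i < n. *)
Definition Zphi_fun (i : 'I_n) (x : Zred n) : int :=
  (\val x : Zfree n) (widen_ord (leqnSn n) i).
Fact Zphi_is_additive i : zmod_morphism (Zphi_fun i).
Proof. by move=> x y; rewrite /Zphi_fun !ffunE. Qed.
HB.instance Definition _ i :=
  GRing.isZmodMorphism.Build (Zred n) int (Zphi_fun i) (Zphi_is_additive i).
Definition Zphi (i : 'I_n) : Zdual n := Zphi_fun i.

Lemma Zphi_vec (i : 'I_n) (j : 'I_n.+1) : Zphi i (Zvec j) = (i == j :> nat)%:R.
Proof.
rewrite /= /homZ_fun /= /Zphi_fun /= !ffunE -!val_eqE /=.
by rewrite [i == n :> nat]ltn_eqF // subr0.
Qed.

Lemma Zphi_sum (f : Zdual n) :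
  f = \sum_(i < n) Zphi i *~ f (Zvec (widen_ord (leqnSn n) i)).
Proof.
apply/additiveP/Zred_ext => j.
transitivity (Zeval (Zvec j) f); first by [].
set s := \sum_i _; transitivity (Zeval (Zvec j) s); last by [].
rewrite raddf_sum; under eq_bigr do rewrite raddfMz [Zeval _ _]Zphi_vec.
have [j_lt|n_le] := ltnP j n; last first.
  have -> : j = ord_max by apply/val_inj/eqP; rewrite eqn_leq -ltnS ltn_ord.
  rewrite Zvec_max [LHS](raddf0 (f : {additive _ -> _})) big1 // => i _.
  by rewrite /= ltn_eqF // mul0rz.
rewrite (bigD1 (Ordinal j_lt)) //= big1 => [|i /negPf ij]; last first.
  by rewrite -[j : nat]/(Ordinal j_lt : nat) val_eqE ij mul0rz.
rewrite eqxx mulrzz mul1r addr0; congr (homZ_fun f (Zvec _)); exact: val_inj.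
Qed.

End Zdual.

Section DualMap.
Variables (m n : nat) (a : {ffun 'I_m.+1 -> 'I_n.+1}).

Definition Zdual_map_fun (f : Zdual n) : Zdual m :=
  (f : {additive Zred n -> int}) \o Zred_map a.
Fact Zdual_map_is_additive : zmod_morphism Zdual_map_fun.
Proof. by move=> f g; apply: additiveP. Qed.
HB.instance Definition _ :=
  GRing.isZmodMorphism.Build (Zdual n) (Zdual m) Zdual_map_fun
    Zdual_map_is_additive.
Definition Zdual_map : {additive Zdual n -> Zdual m} := Zdual_map_fun.

Definition Lmap : {rmorphism exterior (Zdual n) -> exterior (Zdual m)} :=
  emap Zdual_map.

(* delta_a sends phi : Z(n) to phi (v_(a m)); since v_n = 0 this prescribes   *)
(* exactly the values delta_a (phi_i) = [i = a m] on the dual basis.          *)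
Definition Ldelta : {additive exterior (Zdual n) -> exterior (Zdual m)} :=
  ederiv Zdual_map (Zeval (Zvec (a ord_max))).

Lemma Ldelta_phi (i : 'I_n) :
  Ldelta (egen (Zphi i)) = if i == a ord_max :> nat then 1 else 0.
Proof.
rewrite ederiv_gen [Zeval _ _]Zphi_vec.
by case: eqP => _; rewrite ?mulr1z ?mulr0z.
Qed.

Lemma Ldelta_is_derivation : is_derivation Zdual_map Ldelta.
Proof. exact: ederiv_is_derivation. Qed.

Lemma Ldelta_unique
    (D : {additive exterior (Zdual n) -> exterior (Zdual m)}) :
    is_derivation Zdual_map D ->
    (forall i : 'I_n,
      D (egen (Zphi i)) = if i == a ord_max :> nat then 1 else 0) ->
  D =1 Ldelta.
Proof.
move=> Dder Dphi; apply: ederiv_unique => // f; rewrite -(ederiv_gen Zdual_map).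
rewrite [f]Zphi_sum !raddf_sum; apply: eq_bigr => i _.
by rewrite !raddfMz [D _]Dphi [ederiv _ _ _]Ldelta_phi.
Qed.

Definition Lmap_deg i : {additive Lambda (Zdual n) i -> Lambda (Zdual m) i} :=
  emap_deg Zdual_map i.
Definition Ldelta_deg i :
    {additive Lambda (Zdual n) i.+1 -> Lambda (Zdual m) i} :=
  ederiv_deg Zdual_map (Zeval (Zvec (a ord_max))) i.
End DualMap.

Record category := Category {
  ob :> Type;
  hom : ob -> ob -> Type;
  idm : forall X, hom X X;
  mcomp : forall X Y Z, hom Y Z -> hom X Y -> hom X Z;
  mcomp_idl : forall X Y (f : hom X Y), mcomp (idm Y) f = f;
  mcomp_idr : forall X Y (f : hom X Y), mcomp f (idm X) = f;
  mcompA : forall X Y Z W (f : hom Z W) (g : hom Y Z) (h : hom X Y),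
    mcomp f (mcomp g h) = mcomp (mcomp f g) h }.
Arguments hom {c}. Arguments idm {c}. Arguments mcomp {c X Y Z}.

Record functor (C D : category) := Functor {
  fob :> C -> D;
  fmap : forall X Y, hom X Y -> hom (fob X) (fob Y);
  fmap_id : forall X, fmap (idm X) = idm (fob X);
  fmap_comp : forall X Y Z (f : hom Y Z) (g : hom X Y),
    fmap (mcomp f g) = mcomp (fmap f) (fmap g) }.
Arguments fmap {C D} _ {X Y} _.

Definition id_functor (C : category) : functor C C :=
  @Functor C C id (fun _ _ => id) (fun _ => erefl) (fun _ _ _ _ _ => erefl).

Section CompFunctor.
Variables (C D E : category) (G : functor D E) (F : functor C D).
Fact comp_functor_id X : fmap G (fmap F (idm X)) = idm (G (F X)).
Proof. by rewrite !fmap_id. Qed.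
Fact comp_functor_comp X Y Z (f : hom Y Z) (g : hom X Y) :
  fmap G (fmap F (mcomp f g)) = mcomp (fmap G (fmap F f)) (fmap G (fmap F g)).
Proof. by rewrite !fmap_comp. Qed.
Definition comp_functor : functor C E :=
  Functor comp_functor_id comp_functor_comp.
End CompFunctor.

Definition is_iso (C : category) (X Y : C) (f : hom X Y) :=
  exists g : hom Y X, mcomp g f = idm X /\ mcomp f g = idm Y.

Record nat_trans (C D : category) (F G : functor C D) := NatTrans {
  nt :> forall X, hom (F X) (G X);
  nt_natural : forall X Y (f : hom X Y),
    mcomp (nt Y) (fmap F f) = mcomp (fmap G f) (nt X) }.

Definition is_nat_iso (C D : category) (F G : functor C D)
  (eta : nat_trans F G) := forall X, is_iso (eta X).

Definition functor_iso (C D : category) (F G : functor C D) :=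
  exists eta : nat_trans F G, is_nat_iso eta.

(* G is right adjoint to F with invertible unit and counit. *)
Definition adjoint_inverse (C D : category) (F : functor C D)
    (G : functor D C) :=
  exists (eta : nat_trans (id_functor C) (comp_functor G F))
         (eps : nat_trans (comp_functor F G) (id_functor D)),
  [/\ is_nat_iso eta, is_nat_iso eps,
      forall X, mcomp (eps (F X)) (fmap F (eta X)) = idm (F X)
    & forall Y, mcomp (fmap G (eps Y)) (eta (G Y)) = idm (G Y)].

Record delta (m n : nat) := Delta {
  delta_fun :> {ffun 'I_m.+1 -> 'I_n.+1};
  delta_mono : {homo delta_fun : i j / (i <= j)%N} }.

Lemma deltaP m n (a b : delta m n) : a =1 b -> a = b.
Proof.
case: a b => [a am] [b bm] /= /ffunP ab.
by case: _ / ab bm => bm; rewrite (Prop_irrelevance am bm).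
Qed.

Fact delta_id_subproof n : {homo [ffun i : 'I_n.+1 => i] : i j / (i <= j)%N}.
Proof. by move=> i j ij; rewrite !ffunE. Qed.
Definition delta_id n : delta n n := Delta (@delta_id_subproof n).

Section DeltaComp.
Variables (l m n : nat) (a : delta m n) (b : delta l m).
Fact delta_comp_subproof : {homo [ffun i => a (b i)] : i j / (i <= j)%N}.
Proof. by move=> i j ij; rewrite !ffunE; do 2!apply: delta_mono. Qed.
Definition delta_comp : delta l n := Delta delta_comp_subproof.
End DeltaComp.

(* The map [n] -> [n.+1] omitting the value i. *)
Fact coface_subproof n (i : 'I_n.+2) :
  {homo [ffun j : 'I_n.+1 => lift i j] : j k / (j <= k)%N}.
Proof. by move=> j k; rewrite !ffunE /= leq_bump2. Qed.
Definition coface n (i : 'I_n.+2) : delta n n.+1 := Delta (@coface_subproof n i).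

Record simplicial_ab := SimplicialAb {
  sob :> nat -> zmodType;
  smap : forall m n, delta m n -> {additive sob n -> sob m};
  smap_id : forall n, smap (delta_id n) =1 id;
  smap_comp : forall l m n (a : delta m n) (b : delta l m),
    smap (delta_comp a b) =1 smap b \o smap a }.
Arguments smap _ {m n}.

Record simplicial_map (X Y : simplicial_ab) := SimplicialMap {
  smor :> forall n, {additive X n -> Y n};
  smor_natural : forall m n (a : delta m n),
    smor m \o smap X a =1 smap Y a \o smor n }.

Lemma simplicial_mapP (X Y : simplicial_ab) (f g : simplicial_map X Y) :
  (forall n, f n =1 g n) -> f = g.
Proof.
case: f g => [f fn] [g gn] /= fg.
have {}fg : f = g.
  by apply: functional_extensionality_dep => n; apply/additiveP/fg.
by case: _ / fg gn => gn; rewrite (Prop_irrelevance fn gn).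
Qed.

Definition simplicial_map_id (X : simplicial_ab) : simplicial_map X X :=
  @SimplicialMap X X (fun n => idfun) (fun _ _ _ _ => erefl).

Section SimplicialMapComp.
Variables (X Y Z : simplicial_ab).
Variables (f : simplicial_map Y Z) (g : simplicial_map X Y).
Fact simplicial_map_comp_subproof m n (a : delta m n) :
  (f m \o g m) \o smap X a =1 smap Z a \o (f n \o g n).
Proof.
move=> x /=; rewrite [g m _](smor_natural g a x) /=.
exact: (smor_natural f a (g n x)).
Qed.
Definition simplicial_map_comp : simplicial_map X Z :=
  @SimplicialMap X Z (fun n => f n \o g n) simplicial_map_comp_subproof.
End SimplicialMapComp.

Definition sAb : category.
Proof.
apply: (@Category simplicial_ab simplicial_map simplicial_map_id
          simplicial_map_comp);
  by move=> *; apply: simplicial_mapP.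
Defined.

Record chain_complex := ChainComplex {
  cob :> nat -> zmodType;
  cdiff : forall n, {additive cob n.+1 -> cob n};
  cdiff_cdiff : forall n, cdiff n \o cdiff n.+1 =1 (fun=> 0) }.

Record chain_map (A B : chain_complex) := ChainMap {
  cmor :> forall n, {additive A n -> B n};
  cmor_diff : forall n, cmor n \o cdiff A n =1 cdiff B n \o cmor n.+1 }.

Lemma chain_mapP (A B : chain_complex) (f g : chain_map A B) :
  (forall n, f n =1 g n) -> f = g.
Proof.
case: f g => [f fn] [g gn] /= fg.
have {}fg : f = g.
  by apply: functional_extensionality_dep => n; apply/additiveP/fg.
by case: _ / fg gn => gn; rewrite (Prop_irrelevance fn gn).
Qed.

Definition chain_map_id (A : chain_complex) : chain_map A A :=
  @ChainMap A A (fun n => idfun) (fun _ _ => erefl).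

Section ChainMapComp.
Variables (A B C : chain_complex) (f : chain_map B C) (g : chain_map A B).
Fact chain_map_comp_subproof n :
  (f n \o g n) \o cdiff A n =1 cdiff C n \o (f n.+1 \o g n.+1).
Proof.
move=> x /=; rewrite [g n _](cmor_diff g x) /=.
exact: (cmor_diff f (g n.+1 x)).
Qed.
Definition chain_map_comp : chain_map A C :=
  @ChainMap A C (fun n => f n \o g n) chain_map_comp_subproof.
End ChainMapComp.

Definition Ch : category.
Proof.
apply: (@Category chain_complex chain_map chain_map_id chain_map_comp);
  by move=> *; apply: chain_mapP.
Defined.

Section Normalization.
Variable X : simplicial_ab.

Definition face n (i : 'I_n.+2) : {additive X n.+1 -> X n} :=
  smap X (coface i).

(* The intersection of the kernels of d_0, ..., d_(m-1). *)
Definition normal_pred (m : nat) : {pred X m} :=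
  match m with
  | 0 => predT
  | n.+1 => fun x =>
      [forall i : 'I_n.+1, face (widen_ord (leqnSn n.+1) i) x == 0]
  end.

Fact normal_zmod_closed m : zmod_closed (@normal_pred m).
Proof.
case: m => [|n] //; split=> [|x y /forallP x0 /forallP y0].
  by apply/forallP => i; rewrite raddf0.
apply/forallP => i; rewrite raddfB.
by rewrite (eqP (x0 i)) (eqP (y0 i)) subrr.
Qed.
HB.instance Definition _ m :=
  GRing.isZmodClosed.Build (X m) (@normal_pred m) (@normal_zmod_closed m).

Definition normal (m : nat) := subgroup (@normal_pred m).
HB.instance Definition _ m := GRing.Zmodule.on (normal m).

Lemma normalP n (x : X n.+1) : x \in @normal_pred n.+1 ->
  forall i : 'I_n.+2, (i < n.+1)%N -> face i x = 0.
Proof.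
move=> /forallP x0 i i_lt; rewrite -[RHS](eqP (x0 (Ordinal i_lt))).
by congr (face _ x); apply: val_inj.
Qed.

(* d_i d_j = d_(j-1) d_i for i < j, in the form needed for j = k.+1 *)
Lemma face_face n (i k : 'I_n.+2) (x : X n.+2) : (i <= k)%N ->
  face i (face (lift ord0 k) x) =
  face k (face (widen_ord (leqnSn n.+2) i) x).
Proof.
move=> ik; rewrite /face.
rewrite -[LHS]/((smap X _ \o smap X _) x) -[RHS]/((smap X _ \o smap X _) x).
rewrite -!smap_comp; congr (smap X _ x); apply: deltaP => j; apply: val_inj.
rewrite !ffunE /= /bump /=.
by do ![case: leqP => ? //=]; lia.
Qed.

Fact normal_diff_subproof n x :
  x \in @normal_pred n.+1 -> face ord_max x \in @normal_pred n.
Proof.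
case: n x => // n x /normalP x0; apply/forallP => i.
have -> : ord_max = lift ord0 (@ord_max n.+1) by apply: val_inj.
rewrite face_face ?x0 ?raddf0 //=; last by rewrite ltnW // ltnS ltnW.
by rewrite ltnS ltnW.
Qed.

Definition normal_diff n : {additive normal n.+1 -> normal n} :=
  restrict (@normal_diff_subproof n).

Fact normal_diff_diff n : normal_diff n \o normal_diff n.+1 =1 (fun=> 0).
Proof.
move=> x; apply: val_inj; rewrite /=.
have -> : ord_max = lift ord0 (@ord_max n.+1) by apply: val_inj.
by rewrite face_face // (normalP (subgroup_valP x)) ?raddf0.
Qed.

Definition N_complex : chain_complex :=
  @ChainComplex normal normal_diff normal_diff_diff.
End Normalization.

Section NormalizationMap.
Variables (X Y : simplicial_ab) (f : simplicial_map X Y).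

Fact N_map_subproof n x : x \in @normal_pred X n -> f n x \in @normal_pred Y n.
Proof.
case: n x => // n x /forallP x0; apply/forallP => i.
by rewrite /face -[smap _ _ _](smor_natural f) /= (eqP (x0 i)) raddf0.
Qed.

Fact N_map_diff n :
  restrict (@N_map_subproof n) \o normal_diff X n =1
  normal_diff Y n \o restrict (@N_map_subproof n.+1).
Proof. move=> x; apply: val_inj; exact: (smor_natural f). Qed.

Definition N_map : chain_map (N_complex X) (N_complex Y) :=
  @ChainMap (N_complex X) (N_complex Y)
    (fun n => restrict (@N_map_subproof n)) N_map_diff.
End NormalizationMap.

Definition Nfun : functor sAb Ch.
Proof.
apply: (@Functor sAb Ch N_complex N_map) => [X|X Y Z f g];
  by apply: chain_mapP => n x; apply: val_inj.
Defined.

Section K.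
Variable A : chain_complex.

Definition K_term (n i : nat) : zmodType := tensor (A i) (Lambda (Zdual n) i).
Definition K_ob (n : nat) := dsum n (K_term n).
HB.instance Definition _ n := GRing.Zmodule.on (K_ob n).

Section KMap.
Variables (m n : nat) (a : {ffun 'I_m.+1 -> 'I_n.+1}).

Definition K_map_comp (x : K_ob n) (i : nat) : K_term m i :=
  tmap idfun (Lmap_deg a i) (dget i x) +
  tmap (cdiff A i) (Ldelta_deg a i) (dget i.+1 x).

Definition K_map_fun (x : K_ob n) : K_ob m := fun i => K_map_comp x i.

Fact K_map_is_additive : zmod_morphism K_map_fun.
Proof.
move=> x y; apply: functional_extensionality_dep => i.
rewrite -[RHS]/(K_map_comp x i - K_map_comp y i) /K_map_fun /K_map_comp.
by rewrite !raddfB addrACA -opprD.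
Qed.
HB.instance Definition _ :=
  GRing.isZmodMorphism.Build (K_ob n) (K_ob m) K_map_fun K_map_is_additive.
Definition K_map : {additive K_ob n -> K_ob m} := K_map_fun.
End KMap.

(* The summand a (x) phi of degree i, read as 0 when i > n. *)
Definition K_pure n i (a : A i) (phi : Lambda (Zdual n) i) : K_ob n :=
  @dput n (K_term n) i (tpure a phi).

Lemma K_term0 n i (x : K_term n i) : (n < i)%N -> x = 0.
Proof.
move=> lt_ni; have L0 (y : Lambda (Zdual n) i) : y = 0.
  apply: val_inj; apply: (exterior_deg_gt _ lt_ni (subgroup_valP y)) => f.
  by exists (fun i => f (Zvec (widen_ord (leqnSn n) i))); apply: Zphi_sum.
elim/tensor_ind: x => [a b||x ->|x y -> ->]; rewrite ?oppr0 ?addr0 //.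
by rewrite (L0 b); apply: (addIr (tpure a 0)); rewrite -tpureDr addr0 add0r.
Qed.

Lemma dget_K_map m n (a : {ffun 'I_m.+1 -> 'I_n.+1}) x i :
  dget i (K_map a x) = tmap idfun (Lmap_deg a i) (dget i x) +
    tmap (cdiff A i) (Ldelta_deg a i) (dget i.+1 x).
Proof.
have [le_im|lt_mi] := leqP i m; last by rewrite [RHS]K_term0 ?dget_out.
rewrite -ltnS in le_im; rewrite -[i]/(nat_of_ord (Ordinal le_im)).
exact: dget_ord.
Qed.

(* On pure tensors, K(a)(x (x) phi) = x (x) a(phi) + dx (x) delta_a(phi). *)
Lemma K_map_pure0 m n (a : {ffun 'I_m.+1 -> 'I_n.+1}) (x : A 0%N) phi :
  K_map a (@K_pure n 0%N x phi) = K_pure x (Lmap_deg a 0 phi).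
Proof.
apply: functional_extensionality_dep => j; rewrite -!dget_ord dget_K_map.
rewrite [dget j.+1 _]dget_put_neq // raddf0 addr0.
have [->|] := eqVneq (j : nat) 0%N; first by rewrite !dget_put_eq // tmap_pure.
by rewrite eq_sym => j0; rewrite !dget_put_neq // raddf0.
Qed.

Lemma K_map_pureS m n (a : {ffun 'I_m.+1 -> 'I_n.+1}) i (x : A i.+1) phi :
  (i.+1 <= n)%N ->
  K_map a (@K_pure n i.+1 x phi) =
    K_pure x (Lmap_deg a i.+1 phi) + K_pure (cdiff A i x) (Ldelta_deg a i phi).
Proof.
move=> le_in; apply: functional_extensionality_dep => j.
rewrite -[RHS]/(_ j + _ j) -!dget_ord dget_K_map.
have [e|ne1] := eqVneq i.+1 j.
  rewrite -e; congr (_ + _).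
    rewrite dget_put_eq // tmap_pure dget_put_eq //.
    by rewrite e -ltnS.
  by rewrite [in LHS]dget_put_neq ?raddf0 ?dget_put_neq // neq_ltn ltnSn ?orbT.
rewrite [X in tmap idfun _ X]dget_put_neq // raddf0 add0r.
rewrite [X in X + _]dget_put_neq // add0r.
have [e|ne] := eqVneq i j; last by rewrite !dget_put_neq ?raddf0.
by rewrite -e !dget_put_eq ?tmap_pure // e -ltnS.
Qed.

Fact K_map_id n (a : {ffun 'I_n.+1 -> 'I_n.+1}) :
  (forall i, a i = i) -> K_map a =1 id.
Proof.
move=> a1 x; apply: functional_extensionality_dep => i.
rewrite -!dget_ord dget_K_map.
have dual1 : Zdual_map a =1 id.
  move=> f; apply/additiveP/Zred_ext => j.
  rewrite -[LHS]/((f : {additive _ -> _}) (Zred_map a (Zvec j))).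
  by rewrite Zred_map_vec !a1 Zvec_max subr0.
have L1 : tmap idfun (Lmap_deg a i) =1 @idfun (K_term n i).
  apply: (tensor_ext (g := idfun)) => u v; rewrite tmap_pure.
  by congr tpure; apply: val_inj; apply: emap_id.
have D0 : tmap (cdiff A i) (Ldelta_deg a i) =1 (\0 : {additive _ -> _}).
  apply: tensor_ext => u v; rewrite tmap_pure.
  have -> : Ldelta_deg a i v = 0.
    apply: val_inj; apply: ederiv0 => f; rewrite /= /Zeval_fun a1 Zvec_max.
    exact: (raddf0 (f : {additive _ -> _})).
  by apply: (addIr (tpure (cdiff A i u) 0)); rewrite -tpureDr addr0 add0r.
by rewrite L1 D0 addr0.
Qed.

Fact K_map_comp_subproof l m n (c : {ffun 'I_l.+1 -> 'I_n.+1})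
    (a : {ffun 'I_m.+1 -> 'I_n.+1}) (b : {ffun 'I_l.+1 -> 'I_m.+1}) :
  (forall i, c i = a (b i)) -> K_map c =1 K_map b \o K_map a.
Proof.
move=> cE x; apply: functional_extensionality_dep => i.
rewrite -[RHS]/(K_map b (K_map a x) i) -!dget_ord !dget_K_map !raddfD.
have dualE : Zdual_map c =1 Zdual_map b \o Zdual_map a.
  move=> f; apply/additiveP => y.
  rewrite -[LHS]/((f : {additive _ -> _}) (Zred_map c y)).
  rewrite -[RHS]/((f : {additive _ -> _}) (Zred_map a (Zred_map b y))).
  congr ((f : {additive _ -> _}) _); move: y.
  apply: (Zred_ext (g := Zred_map a \o Zred_map b)) => j.
  rewrite -[RHS]/(Zred_map a (Zred_map b (Zvec j))) !Zred_map_vec raddfB.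
  by rewrite !Zred_map_vec !cE opprB addrA subrK.
have L_comp j : tmap idfun (Lmap_deg c j) =1
    tmap idfun (Lmap_deg b j) \o tmap (@idfun (A j)) (Lmap_deg a j).
  apply: (tensor_ext (g := tmap _ _ \o tmap _ _)) => u v.
  rewrite -[RHS]/(tmap _ _ (tmap _ _ _)) !tmap_pure; congr tpure.
  by apply: val_inj; apply: emap_comp.
have D_comp : tmap (cdiff A i) (Ldelta_deg c i) =1
    (tmap idfun (Lmap_deg b i) \o tmap (cdiff A i) (Ldelta_deg a i)) \+
    (tmap (cdiff A i) (Ldelta_deg b i) \o tmap idfun (Lmap_deg a i.+1)).
  apply: (tensor_ext (g := (tmap _ _ \o tmap _ _) \+ (tmap _ _ \o tmap _ _))).
  move=> u v.
  rewrite -[RHS]/(tmap _ _ (tmap _ _ _) + tmap _ _ (tmap _ _ _)) !tmap_pure.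
  rewrite -tpureDr; congr tpure.
  apply: val_inj; rewrite [RHS]addrC; apply: ederiv_comp => // f.
  rewrite -[Zeval _ _ in LHS]/((f : {additive _ -> _}) _).
  rewrite -[X in X + _]/((f : {additive _ -> _}) (Zred_map a (Zvec (b ord_max)))).
  rewrite -[X in _ + X]/((f : {additive _ -> _}) _).
  by rewrite Zred_map_vec -raddfD subrK cE.
have D_D : tmap (cdiff A i) (Ldelta_deg b i) \o
    tmap (cdiff A i.+1) (Ldelta_deg a i.+1) =1 (fun=> 0).
  apply: (tensor_ext (f := tmap _ _ \o tmap _ _) (g := \0)) => u v.
  rewrite -[LHS]/(tmap _ _ (tmap _ _ _)) !tmap_pure [cdiff A i _](cdiff_cdiff u).
  by apply: (addIr (tpure 0 (Ldelta_deg b i (Ldelta_deg a i.+1 v))));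
     rewrite -tpureDl addr0 add0r.
rewrite L_comp D_comp [X in _ = _ + (_ + X)](D_D _) addr0 -addrA.
by [].
Qed.

Fact K_smap_id n : K_map (delta_id n) =1 id.
Proof. by apply: K_map_id => i; rewrite ffunE. Qed.

Fact K_smap_comp l m n (a : delta m n) (b : delta l m) :
  K_map (delta_comp a b) =1 K_map b \o K_map a.
Proof. by apply: K_map_comp_subproof => i; rewrite ffunE. Qed.

Definition K_simplicial : simplicial_ab :=
  @SimplicialAb K_ob (fun m n (a : delta m n) => K_map a)
    K_smap_id K_smap_comp.
End K.

Section KChainMap.
Variables (A B : chain_complex) (f : chain_map A B).

Definition K_mor_fun n (x : K_ob A n) : K_ob B n :=
  fun i => tmap (f i) idfun (x i).

Fact K_mor_is_additive n : zmod_morphism (@K_mor_fun n).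
Proof.
move=> x y; apply: functional_extensionality_dep => i.
exact: (raddfB (tmap (f i) idfun)).
Qed.
HB.instance Definition _ n :=
  GRing.isZmodMorphism.Build (K_ob A n) (K_ob B n) (@K_mor_fun n)
    (@K_mor_is_additive n).
Definition K_mor n : {additive K_ob A n -> K_ob B n} := @K_mor_fun n.

Lemma dget_K_mor n i x : dget i (K_mor n x) = tmap (f i) idfun (dget i x).
Proof.
have [le_in|lt_ni] := leqP i n; last by rewrite !dget_out // raddf0.
by rewrite -ltnS in le_in; rewrite -[i]/(nat_of_ord (Ordinal le_in)) !dget_ord.
Qed.

Fact K_mor_natural m n (a : delta m n) :
  K_mor m \o K_map A a =1 K_map B a \o K_mor n.
Proof.
move=> x; apply: functional_extensionality_dep => i.
rewrite -[LHS]/(K_mor m (K_map A a x) i) -[RHS]/(K_map B a (K_mor n x) i).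
rewrite -!dget_ord dget_K_mor !dget_K_map !dget_K_mor raddfD; congr (_ + _).
  move: (dget _ _).
  apply: (tensor_ext (f := tmap _ _ \o tmap _ _) (g := tmap _ _ \o tmap _ _)).
  move=> u v.
  by rewrite -[LHS]/(tmap _ _ (tmap _ _ _)) -[RHS]/(tmap _ _ (tmap _ _ _))
             !tmap_pure.
move: (dget _ _).
apply: (tensor_ext (f := tmap _ _ \o tmap _ _) (g := tmap _ _ \o tmap _ _)).
move=> u v; rewrite -[LHS]/(tmap _ _ (tmap _ _ _)).
rewrite -[RHS]/(tmap _ _ (tmap _ _ _)) !tmap_pure.
by rewrite [f i _](cmor_diff f u).
Qed.

Definition K_simplicial_map :
    simplicial_map (K_simplicial A) (K_simplicial B) :=
  @SimplicialMap (K_simplicial A) (K_simplicial B) K_mor K_mor_natural.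
End KChainMap.

Definition Kfun : functor Ch sAb.
Proof.
apply: (@Functor Ch sAb K_simplicial K_simplicial_map) => [A|A B C f g];
  apply: simplicial_mapP => n x; apply: functional_extensionality_dep => i.
  apply: (tensor_ext (f := tmap _ _) (g := idfun)) => u v.
  by rewrite tmap_pure.
apply: (tensor_ext (f := tmap _ _) (g := tmap _ _ \o tmap _ _)) => u v.
by rewrite -[RHS]/(tmap _ _ (tmap _ _ _)) !tmap_pure.
Defined.

(* Main.v *)
(* For i < n put psi_i = phi_0 + ... + phi_i; these form a basis of Z(n),     *)
(* dual to the e_i - e_(i+1).  Pulling psi_j back along a monotone surjection *)
(* [n] -> [k] gives psi_l, with l the last point sent to j or below.  Hence,  *)
(* with omega_k = psi_(k-1) ^ ... ^ psi_0, the k-fold wedges psi_S are the    *)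
(* sigma_S^* omega_k for sigma_S running over these surjections.              *)
(*   N K = 1: in the basis phi, the face d_j (j < n) kills the wedges that    *)
(* contain phi_j and is injective on the span of the others, so a normalized  *)
(* n-chain has no component outside A_n (x) omega_n.                          *)
(*   K N = 1: x (x) psi_S |-> sigma_S^* x is a simplicial map K N X -> X.     *)
(* Composing its normalization with N X = N K N X gives the identity, and N   *)
(* reflects isomorphisms.                                                     *)
(*   Coordinates in an exterior power are iterated contractions followed by   *)
(* the augmentation.                                                          *)

From HB Require Import structures.
From mathcomp Require Import all_boot all_algebra.
From mathcomp Require Import boolp zify.
Require Import Defs.

Set Implicit Arguments.
Unset Strict Implicit.
Unset Printing Implicit Defensive.

Import GRing.Theory.

Local Open Scope ring_scope.

(** * Coordinates in exterior powers *)

(** Everything is governed by one element, [omega n], the generator of the top exterior power of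
    Z(n). All faces but the last send x (x) omega_n to 0, and the last sends it to dx (x)
    omega_(n-1) ([K_face_max_omega]). So x |-> x (x) omega_n is a chain map A -> N K A, and
    [normal_K_deg] shows that it reaches every normalized chain.

    Every x (x) psi_S is the pullback of some x (x) omega_k along a surjection ([K_map_sigma]). A
    simplicial map out of K N X is thus fixed by its values on these, and [KN_counit_map_omega]
    shows that x (x) omega_k |-> x is a consistent choice. It is bijective on normalized chains, and
    [N_map_inj] and [N_map_surj] extend this to all simplices by induction on the dimension.

    The maps A -> N K A and K N X -> X satisfy the triangle identities. Being invertible, they can
    be reversed, which makes K an adjoint inverse of N; any other one, G, satisfies K = G N K = G up
    to isomorphism. *)

Section Contraction.
Variable M : zmodType.
Implicit Types (l : {additive M -> int}) (ls : seq {additive M -> int}).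

Definition contract l : {additive exterior M -> exterior M} := ederiv idfun l.

Lemma contract1 l : contract l 1 = 0.
Proof. exact: ederiv1. Qed.

Lemma contract_genM l m y :
  contract l (egen m * y) = y *~ l m - egen m * contract l y.
Proof.
rewrite [LHS]ederivM ederiv_gen emap_gen esign_gen mulNr mulrzl.
by rewrite emap_id.
Qed.

Fact augmentation_sqr (m : M) : \0 m * \0 m = 0 :> int.
Proof. by rewrite mul0r. Qed.

Definition augmentation : {rmorphism exterior M -> int} :=
  elift augmentation_sqr.

Lemma augmentation_genM m y : augmentation (egen m * y) = 0.
Proof. by rewrite rmorphM [X in X * _]elift_gen mul0r. Qed.

Fixpoint contractions ls : {additive exterior M -> int} :=
  if ls is l :: ls then contractions ls \o contract l else augmentation.

Lemma contractions_cons l ls y :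
  contractions (l :: ls) y = contractions ls (contract l y).
Proof. by []. Qed.
End Contraction.

(** Both sides are the g-derivation extending [l \o g]: [ederiv_comp] yields each of them when the
    other factor of the composite carries the zero functional. *)
Lemma contract_emap (M M' : zmodType) (g : {additive M -> M'})
    (l : {additive M' -> int}) y :
  contract l (emap g y) = emap g (contract (l \o g : {additive M -> int}) y).
Proof.
have E1 := @ederiv_comp M M' M' g idfun g \0 (l \o g) l.
have E2 := @ederiv_comp M M M' idfun g g (l \o g) (l \o g) \0.
transitivity (ederiv g (l \o g) y).
  rewrite E1 => [|//|m]; last by rewrite addr0.
  by rewrite (@ederiv0 _ _ _ \0) // raddf0 addr0.
by rewrite E2 => [|//|m]; rewrite ?(@ederiv0 _ _ _ \0) // add0r.
Qed.

Lemma contractions_emap (M M' : zmodType) (g : {additive M -> M'}) ls y :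
  contractions ls (emap g y) =
  contractions
    [seq l \o g : {additive M -> int} | l : {additive M' -> int} <- ls] y.
Proof.
elim: ls y => [|l ls IH] y; last first.
  by rewrite map_cons !contractions_cons contract_emap IH.
have aug_emap :
    (@augmentation M' \o emap g : {rmorphism _ -> _}) =1 @augmentation M.
  by apply: exterior_ext => m; rewrite /= emap_gen !elift_gen.
exact: aug_emap.
Qed.

(** Decreasing words stand for subsets, so that decreasing k-tuples index a basis of the k-th
    exterior power. *)
Definition decreasing n (w : seq 'I_n) :=
  sorted (fun i j : 'I_n => (j < i)%N) w.

Lemma decreasing_cons n (i : 'I_n) w :
  decreasing (i :: w) = all (fun j : 'I_n => (j < i)%N) w && decreasing w.
Proof.
rewrite /decreasing /= path_sortedE // => i1 i2 i3 i21 i13.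
exact: ltn_trans i13 i21.
Qed.

Section ExteriorBasis.
Variables (M : zmodType) (n : nat) (b : 'I_n -> M).
Variable d : 'I_n -> {additive M -> int}.
Hypothesis d_b : forall i j, d i (b j) = (i == j)%:R.
Hypothesis b_sum : forall m, m = \sum_(i < n) b i *~ d i m.
Implicit Types (w S T : seq 'I_n).

Definition wedge w : exterior M := \prod_(i <- w) egen (b i).

Definition coord w : {additive exterior M -> int} :=
  contractions [seq d i | i <- w].

Lemma wedge_cons i w : wedge (i :: w) = egen (b i) * wedge w.
Proof. exact: big_cons. Qed.

Lemma wedge_deg k (S : k.-tuple 'I_n) : wedge S \in exterior_deg M k.
Proof.
rewrite /wedge -(big_map b xpredT (@egen M)).
exact: (exterior_deg_prod (map_tuple b S)).
Qed.

Definition wedge_tuple k (S : k.-tuple 'I_n) : Lambda M k :=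
  Subgroup (wedge_deg S).

Lemma contract_wedge_notin i w : i \notin w -> contract (d i) (wedge w) = 0.
Proof.
elim: w => [|j w IH]; first by rewrite /wedge big_nil contract1.
rewrite inE negb_or => /andP[/negPf ij /IH w0].
by rewrite wedge_cons contract_genM d_b ij w0 mulr0 subr0.
Qed.

Lemma coord_notin i w y : i \notin w -> coord w (egen (b i) * y) = 0.
Proof.
elim: w y => [|j w IH] y; first by rewrite [LHS]augmentation_genM.
rewrite inE negb_or eq_sym => /andP[/negPf ij iw].
rewrite /coord map_cons contractions_cons contract_genM d_b ij sub0r raddfN.
by rewrite [X in - X]IH ?oppr0.
Qed.

(** Compare the heads. The larger one does not occur in the other word: it is either a factor that
    no contraction removes or a contraction that kills the wedge. Equal heads cancel without a
    sign. *)
Lemma coord_wedge S T : decreasing S -> decreasing T ->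
  coord S (wedge T) = (S == T)%:R.
Proof.
elim: S T => [|s S IH] [|t T].
- by rewrite /wedge big_nil [LHS]rmorph1.
- by rewrite wedge_cons [LHS]augmentation_genM.
- rewrite /wedge big_nil /coord map_cons contractions_cons contract1.
  by rewrite raddf0.
move=> decS; have := decS; rewrite !decreasing_cons => /andP[ltS dS].
case/andP=> ltT dT; have [st|ts|/val_inj st] := ltngtP s t.
- rewrite [in RHS]eqseq_cons -val_eqE ltn_eqF // wedge_cons coord_notin //.
  rewrite inE negb_or -val_eqE gtn_eqF //=; apply/negP => /(allP ltS) /=.
  by rewrite ltnNge ltnW.
- rewrite [in RHS]eqseq_cons -val_eqE gtn_eqF //.
  rewrite /coord map_cons contractions_cons contract_wedge_notin ?raddf0 //.
  rewrite inE negb_or -val_eqE gtn_eqF //=; apply/negP => /(allP ltT) /=.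
  by rewrite ltnNge ltnW.
rewrite -st eqseq_cons eqxx andTb -IH // /coord map_cons contractions_cons.
rewrite wedge_cons contract_genM d_b eqxx mulr1z contract_wedge_notin ?mulr0.
  by rewrite subr0.
by rewrite st; apply/negP => /(allP ltT) /=; rewrite ltnn.
Qed.

(** One step of insertion sort: passing a larger factor costs a sign, meeting an equal one gives
    0. *)
Lemma wedge_insert i w : decreasing w ->
  egen (b i) * wedge w = 0 \/
  exists S (c : int), [/\ decreasing S, perm_eq S (i :: w) &
    egen (b i) * wedge w = wedge S *~ c].
Proof.
elim: w => [|j w IH] decw.
  by right; exists [:: i], 1; rewrite -wedge_cons mulr1z.
have := decw; rewrite decreasing_cons => /andP[ltw dw].
have [ij|ji|/val_inj <-] := ltngtP i j; last first.
- by left; rewrite wedge_cons mulrA egen_sqr mul0r.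
- right; exists [:: i, j & w], 1; rewrite mulr1z -wedge_cons; split=> //.
  rewrite decreasing_cons decw /= ji andbT.
  by apply/allP => k /(allP ltw) kj; apply: ltn_trans kj ji.
rewrite wedge_cons mulrA egen_anticomm mulNr -mulrA.
have [->|[S [c [decS permS ->]]]] := IH dw; first by left; rewrite mulr0 oppr0.
right; exists (j :: S), (- c); split.
- rewrite decreasing_cons decS andbT (perm_all _ permS) /= ij; exact: ltw.
- rewrite -[i :: _]cat1s perm_sym perm_catC /= perm_cons.
  by rewrite perm_sym (perm_trans permS) // -cat1s perm_catC.
by rewrite mulrzAr -wedge_cons mulrNz.
Qed.

Lemma wedge_sort w : wedge w = 0 \/
  exists S (c : int), [/\ decreasing S, perm_eq S w & wedge w = wedge S *~ c].
Proof.
elim: w => [|i w [w0|[S [c [decS permS wS]]]]].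
- by right; exists [::], 1; rewrite mulr1z.
- by left; rewrite wedge_cons w0 mulr0.
rewrite wedge_cons wS mulrzAr.
have [->|[T [e [decT permT ->]]]] := wedge_insert i decS.
  by left; rewrite mul0rz.
right; exists T, (e * c); rewrite mulrzA; split=> //.
by rewrite (perm_trans permT) // perm_cons.
Qed.

Lemma exterior_deg_expand k y : y \in exterior_deg M k ->
  y = \sum_(S : k.-tuple 'I_n | decreasing S) wedge S *~ coord S y.
Proof.
(* [F] is additive, so it is enough that it fixes k-fold products. *)
pose F : exterior M -> exterior M := fun y =>
  \sum_(S : k.-tuple 'I_n | decreasing S) wedge S *~ coord S y.
have FMz x c : F (x *~ c) = F x *~ c.
  rewrite /F mulrz_suml; apply: eq_bigr => S _.
  by rewrite raddfMz -mulrzA mulrzz.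
have FD x z : F (x + z) = F x + F z.
  rewrite /F -big_split; apply: eq_bigr => S _.
  by rewrite raddfD mulrzDr.
have F0 : F 0 = 0 by rewrite -(mulr0z (0 : exterior M)) FMz mulr0z.
have Fsum I (r : seq I) (G : I -> exterior M) :
    (forall i, F (G i) = G i) -> F (\sum_(i <- r) G i) = \sum_(i <- r) G i.
  by move=> FG; elim: r => [|i r IH]; rewrite ?big_nil // !big_cons FD FG IH.
have Fwedge S : size S = k -> F (wedge S) = wedge S.
  have [-> //|[{S}S [c [decS /perm_size <- ->]]] Sk] := wedge_sort S.
  rewrite FMz; congr (_ *~ c); have /eqP Sk' := Sk.
  rewrite /F (bigD1 (Tuple Sk')) //= big1 ?addr0 => [|T /andP[decT TS]].
    by rewrite coord_wedge // eqxx mulr1z.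
  rewrite coord_wedge //; move: TS; rewrite -val_eqE /= => /negPf ->.
  by rewrite mulr0z.
(* Expanding the head of t in the basis moves the factors one by one from t into the word w. *)
have Fprod w (t : seq M) : (size w + size t)%N = k ->
    F (wedge w * \prod_(m <- t) egen m) = wedge w * \prod_(m <- t) egen m.
  elim: t w => [|m t IH] w sz.
    by rewrite big_nil mulr1 Fwedge // -sz addn0.
  rewrite big_cons [m]b_sum raddf_sum mulr_suml mulr_sumr.
  apply: Fsum => i; rewrite raddfMz mulrzAl mulrzAr FMz; congr (_ *~ _).
  have := IH (rcons w i); rewrite size_rcons addSnnS => /(_ sz).
  by rewrite /wedge big_rcons mulrA.
move=> /asboolP[s ->]; rewrite -[RHS]/(F _) Fsum // => -[c t] /=.
have := Fprod [::] t; rewrite /wedge big_nil mul1r size_tuple => /(_ erefl) Ft.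
by rewrite FMz Ft.
Qed.

Lemma Lambda_expand k (y : Lambda M k) :
  y = \sum_(S : k.-tuple 'I_n | decreasing S) wedge_tuple S *~ coord S (\val y).
Proof.
apply: val_inj; rewrite raddf_sum [LHS](exterior_deg_expand (subgroup_valP y)).
by apply: eq_bigr => S _; rewrite raddfMz.
Qed.

Section Tensor.
Variable A : zmodType.

Section Coef.
Variables (k : nat) (S : seq 'I_n).

Fact tensor_coord_Dl (y : Lambda M k) :
  {morph (fun a : A => a *~ coord S (\val y)) : a a' / a + a'}.
Proof. by move=> a a'; rewrite mulrzDl. Qed.

Fact tensor_coord_Dr (a : A) :
  {morph (fun y : Lambda M k => a *~ coord S (\val y)) : y y' / y + y'}.
Proof. by move=> y y'; rewrite !raddfD. Qed.

Definition tensor_coord : {additive tensor A (Lambda M k) -> A} :=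
  tlift tensor_coord_Dl tensor_coord_Dr.

Lemma tensor_coord_pure a y :
  tensor_coord (tpure a y) = a *~ coord S (\val y).
Proof. exact: tlift_pure. Qed.
End Coef.

Lemma tensor_coord_wedge k (S T : k.-tuple 'I_n) a :
  decreasing S -> decreasing T ->
  tensor_coord k S (tpure a (wedge_tuple T)) = if S == T then a else 0.
Proof.
move=> decS decT; rewrite tensor_coord_pure coord_wedge // val_eqE.
by case: eqP; rewrite ?mulr1z ?mulr0z.
Qed.
End Tensor.
End ExteriorBasis.
Arguments tensor_coord {M n} d {A k} S.

Section TensorPure.
Variables A B : zmodType.

Fact tpure_is_additive (a : A) : zmod_morphism (@tpure A B a).
Proof. by move=> x y; apply: (addIr (tpure a y)); rewrite -tpureDr !subrK. Qed.
HB.instance Definition _ a :=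
  GRing.isZmodMorphism.Build B (tensor A B) (@tpure A B a)
    (tpure_is_additive a).

Lemma tpure0l (b : B) : tpure (0 : A) b = 0.
Proof. by apply: (addIr (tpure 0 b)); rewrite -tpureDl addr0 add0r. Qed.

Lemma tpureNl (a : A) (b : B) : tpure (- a) b = - tpure a b.
Proof.
by apply: (addIr (tpure a b)); rewrite -tpureDl [- a + a]addNr tpure0l addNr.
Qed.

Lemma tpureMzl (a : A) (b : B) c : tpure (a *~ c) b = tpure a b *~ c.
Proof.
have tMn (x : A) k : tpure (x *+ k) b = tpure x b *+ k.
  by elim: k => [|k IH]; rewrite ?mulr0n ?tpure0l // !mulrS tpureDl IH.
by case: c => k; rewrite ?NegzE ?mulrNz ?tpureNl tMn.
Qed.
End TensorPure.

Lemma tensor_expand (M : zmodType) n (b : 'I_n -> M)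
    (d : 'I_n -> {additive M -> int}) (A : zmodType) k
    (z : tensor A (Lambda M k)) :
    (forall i j, d i (b j) = (i == j)%:R) ->
    (forall m, m = \sum_(i < n) b i *~ d i m) ->
  z = \sum_(S : k.-tuple 'I_n | decreasing S)
        tpure (tensor_coord d S z) (wedge_tuple b S).
Proof.
move=> d_b b_sum; elim/tensor_ind: z => [a y||x {1}->|x y {1}-> {1}->].
- rewrite {1}(Lambda_expand d_b b_sum y) raddf_sum; apply: eq_bigr => S _.
  by rewrite raddfMz tensor_coord_pure tpureMzl.
- by rewrite big1 // => S _; rewrite raddf0 tpure0l.
- rewrite -sumrN; apply: eq_bigr => S _.
  by rewrite raddfN tpureNl.
by rewrite -big_split; apply: eq_bigr => S _; rewrite raddfD tpureDl.
Qed.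

(** * Two bases of Z(n) *)

Section DualBases.
Variable n : nat.
Implicit Types (f g : Zdual n) (i j : 'I_n).

Lemma Zdual_ext f g : (forall i : 'I_n.+1, f (Zvec i) = g (Zvec i)) -> f = g.
Proof. by move=> fg; apply/additiveP/Zred_ext. Qed.

Definition phi_dual i : {additive Zdual n -> int} :=
  Zeval (Zvec (widen_ord (leqnSn n) i)).

Lemma phi_dualE i j : phi_dual i (Zphi j) = (i == j)%:R.
Proof. by rewrite [LHS]Zphi_vec eq_sym. Qed.

Lemma phi_dual_sum f : f = \sum_i Zphi i *~ phi_dual i f.
Proof. exact: Zphi_sum. Qed.

Definition Zpsi i : Zdual n := \sum_(l < n | (l <= i)%N) Zphi l.

Lemma Zpsi_vec i (j : 'I_n.+1) : Zpsi i (Zvec j) = (j <= i)%N%:R.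
Proof.
rewrite -[LHS]/(Zeval (Zvec j) (Zpsi i)) raddf_sum.
under eq_bigr do rewrite [Zeval _ _]Zphi_vec.
have [ji|ij] := leqP j i; last first.
  rewrite big1 // => l li; rewrite ltn_eqF //; exact: leq_ltn_trans li ij.
rewrite (bigD1 (Ordinal (leq_ltn_trans ji (ltn_ord i)))) //= eqxx.
by rewrite big1 ?addr0 // => l /andP[_]; rewrite -val_eqE /= => /negPf ->.
Qed.

Definition psi_dual i : {additive Zdual n -> int} :=
  Zeval (Zvec (widen_ord (leqnSn n) i) - Zvec (lift ord0 i)).

Lemma psi_dual_vec i f :
  psi_dual i f = f (Zvec (widen_ord (leqnSn n) i)) - f (Zvec (lift ord0 i)).
Proof. exact: (raddfB (f : {additive _ -> _})). Qed.

Lemma psi_dualE i j : psi_dual i (Zpsi j) = (i == j)%:R.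
Proof.
rewrite psi_dual_vec !Zpsi_vec /= /bump /= add1n -val_eqE.
by case: ltngtP; rewrite ?subrr ?subr0.
Qed.

(** At v_j only the terms with i >= j survive, and the differences f(v_i) - f(v_(i+1)) telescope to
    f(v_j), since v_n = 0. *)
Lemma psi_dual_sum f : f = \sum_i Zpsi i *~ psi_dual i f.
Proof.
apply: Zdual_ext => j; set s := \sum_i _.
rewrite -[RHS]/(Zeval (Zvec j) s) raddf_sum.
pose g l := f (Zvec (inord l)).
transitivity (\sum_(j <= l < n) (g l - g l.+1)).
  rewrite -[LHS]opprK -[RHS]opprK; congr (- _).
  rewrite -sumrN; under eq_bigr do rewrite opprB; rewrite telescope_sumr.
    have -> : g n = 0.
      rewrite /g; have -> : inord n = ord_max :> 'I_n.+1.
        by apply: val_inj; rewrite /= inordK.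
      by rewrite Zvec_max; apply: (raddf0 (f : {additive _ -> _})).
    by rewrite sub0r /g inord_val.
  by rewrite -ltnS.
rewrite (big_nat_widenl _ 0%N) // big_mkord big_mkcond; apply: eq_bigr => l _.
rewrite raddfMz [Zeval _ _]Zpsi_vec psi_dual_vec /g.
have -> : inord l = widen_ord (leqnSn n) l.
  by apply: val_inj; rewrite /= inordK // ltnW // ltnS.
have -> : inord l.+1 = lift ord0 l.
  by apply: val_inj; rewrite /= inordK // ltnS.
by case: leqP => _; rewrite ?mul0rz // mulrzz mul1r.
Qed.
End DualBases.

Lemma Zdual_map_vec m n (a : {ffun 'I_m.+1 -> 'I_n.+1}) (f : Zdual n) i :
  Zdual_map a f (Zvec i) = f (Zvec (a i)) - f (Zvec (a ord_max)).
Proof.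
rewrite -[LHS]/((f : {additive _ -> _}) (Zred_map a (Zvec i))) Zred_map_vec.
exact: raddfB.
Qed.

Lemma emap_wedge (M M' : zmodType) n n' (b : 'I_n -> M) (b' : 'I_n' -> M')
    (g : {additive M -> M'}) (s : 'I_n -> 'I_n') :
    (forall i, g (b i) = b' (s i)) ->
  forall w, emap g (wedge b w) = wedge b' (map s w).
Proof.
move=> gb w; rewrite /wedge rmorph_prod big_map; apply: eq_bigr => i _.
by rewrite emap_gen gb.
Qed.

Lemma ederiv_wedge0 (M M' : zmodType) n (b : 'I_n -> M)
    (g : {additive M -> M'}) (l : {additive M -> int}) w :
  (forall i, i \in w -> l (b i) = 0) -> ederiv g l (wedge b w) = 0.
Proof.
elim: w => [|i w IH] lb; first by rewrite /wedge big_nil ederiv1.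
rewrite wedge_cons ederivM ederiv_gen lb ?mem_head // mul0r add0r.
by rewrite IH ?mulr0 // => j jw; rewrite lb // inE jw orbT.
Qed.

Lemma decreasing_eq n (S T : seq 'I_n) :
  decreasing S -> decreasing T -> S =i T -> S = T.
Proof.
move=> dS dT; apply: irr_sorted_eq dS dT; last by move=> i; rewrite /= ltnn.
by move=> i1 i2 i3 i21 i13; apply: ltn_trans i13 i21.
Qed.

Lemma decreasing_uniq n (S : seq 'I_n) : decreasing S -> uniq S.
Proof.
apply: sorted_uniq; last by move=> i; rewrite /= ltnn.
by move=> i1 i2 i3 i21 i13; apply: ltn_trans i13 i21.
Qed.

Lemma decreasing_size n (S : seq 'I_n) : decreasing S -> (size S <= n)%N.
Proof.
by move/decreasing_uniq/card_uniqP <-; rewrite -[leqRHS]card_ord max_card.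
Qed.

Definition top_tuple k : k.-tuple 'I_k := rev_tuple (ord_tuple k).

Lemma decreasing_map m n (s : 'I_m -> 'I_n) w :
  {homo s : i j / (i < j)%N} -> decreasing w -> decreasing (map s w).
Proof. by move=> s_mono; apply: homo_sorted => i j; apply: s_mono. Qed.

Lemma decreasing_top k : decreasing (top_tuple k).
Proof.
rewrite /decreasing rev_sorted.
by have := iota_ltn_sorted 0 k; rewrite -val_enum_ord sorted_map.
Qed.

Lemma mem_top k i : i \in top_tuple k.
Proof. by rewrite mem_rev mem_enum. Qed.

Lemma decreasing_top_unique k (S : k.-tuple 'I_k) :
  decreasing S -> S = top_tuple k.
Proof.
move=> dS; apply/val_inj/decreasing_eq => //; first exact: decreasing_top.
have sub : {subset S <= top_tuple k} by move=> i _; apply: mem_top.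
have [|_ //] := uniq_min_size (decreasing_uniq dS) sub.
by rewrite !size_tuple.
Qed.

Lemma top_tupleS k : val (top_tuple k.+1) =
  ord_max :: [seq widen_ord (leqnSn k) i | i <- top_tuple k].
Proof. by rewrite /= enum_ordSr rev_rcons map_rev. Qed.

(* In descending order, so that the last face of omega carries no sign. *)
Definition omega k : Lambda (Zdual k) k := wedge_tuple (@Zpsi k) (top_tuple k).

(** * Monotone surjections and wedges *)

Section Sigma.
Variables n k : nat.
Implicit Types (S : k.-tuple 'I_n) (i : 'I_n.+1).

Fact sigma_subproof S i : (count (fun s : 'I_n => s < i) S < k.+1)%N.
Proof. by rewrite ltnS -[leqRHS](size_tuple S) count_size. Qed.

Fact sigma_mono S :
  {homo [ffun i => Ordinal (sigma_subproof S i)] : i j / (i <= j)%N}.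
Proof.
by move=> i j ij; rewrite !ffunE; apply: sub_count => s /= /leq_trans; apply.
Qed.

(* The surjection [n] -> [k] that jumps right after each element of S. *)
Definition sigma S : delta n k := Delta (@sigma_mono S).

(** [sigma S] counts the elements of S below i, so it stays at most j up to the element of S with j
    smaller ones. Pullbacks of the psi_j are computed from this form. *)
Lemma sigma_threshold S : decreasing S -> forall i (j : 'I_k),
  (i <= tnth (rev_tuple S) j)%N = (sigma S i <= j)%N.
Proof.
move=> dS i j; rewrite ffunE /= -count_rev (tnth_nth (tnth (rev_tuple S) j)) /=.
(* The default value of [nth] mentions S and is generalized before the induction on the ascending
   word. *)
set x0 := tnth _ _; clearbody x0; have := ltn_ord j.
rewrite -[in X in (_ < X)%N](size_tuple (rev_tuple S)).
move: dS; rewrite /decreasing -rev_sorted /=.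
elim: (rev S) (nat_of_ord j) => // t T IH {}j /= pT.
have tr : transitive (fun i j : 'I_n => (i < j)%N).
  by move=> ? ? ?; apply: ltn_trans.
have := pT; rewrite path_sortedE // => /andP[ltT sT].
have [ti|it] := ltnP t i.
  by case: j => [|j] /= jT; rewrite ?add1n ?ltnS ?IH // leqNgt ti.
have -> : count (fun s : 'I_n => (s < i)%N) T = 0.
  apply/eqP; rewrite -leqn0 leqNgt -has_count; apply/hasPn => s /(allP ltT) /=.
  by move=> ts; rewrite -leqNgt ltnW // (leq_ltn_trans it).
case: j => [//|j] /= jT; rewrite leq0n (leq_trans it) // ltnW //.
exact/(allP ltT)/mem_nth.
Qed.
End Sigma.

Section Threshold.
Variables (m k : nat) (a : {ffun 'I_m.+1 -> 'I_k.+1}) (s : 'I_k -> 'I_m).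
Hypothesis a_s : forall (i : 'I_m.+1) (j : 'I_k), (i <= s j)%N = (a i <= j)%N.

Lemma threshold_max : a ord_max = ord_max.
Proof.
apply/val_inj/eqP; rewrite eqn_leq -ltnS ltn_ord /= leqNgt; apply/negP => ltk.
by have := a_s ord_max (Ordinal ltk); rewrite /= leqnn leqNgt ltn_ord.
Qed.

(** On the v_l, psi_j is the indicator of l <= j, and it vanishes at v_k; pulling back along a moves
    the threshold from j to s j. *)
Lemma threshold_psi j : Zdual_map a (Zpsi j) = Zpsi (s j).
Proof.
apply: Zdual_ext => i; rewrite Zdual_map_vec !Zpsi_vec a_s threshold_max /=.
by rewrite [(k <= j)%N]leqNgt ltn_ord subr0.
Qed.

Lemma threshold_omega :
  Lmap_deg a k (omega k) = wedge_tuple (@Zpsi m) (map_tuple s (top_tuple k)).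
Proof. by apply: val_inj; apply: emap_wedge; apply: threshold_psi. Qed.
End Threshold.

Lemma map_tnth_top n k (S : k.-tuple 'I_n) :
  map_tuple (tnth (rev_tuple S)) (top_tuple k) = S.
Proof. by apply: val_inj; rewrite /= map_rev map_tnth_enum /= revK. Qed.

Lemma sigma_max n k (S : k.-tuple 'I_n) :
  decreasing S -> sigma S ord_max = ord_max.
Proof. by move=> dS; apply/threshold_max/sigma_threshold. Qed.

Lemma sigma_omega n k (S : k.-tuple 'I_n) :
  decreasing S -> Lmap_deg (sigma S) k (omega k) = wedge_tuple (@Zpsi n) S.
Proof.
by move=> dS; rewrite (threshold_omega (sigma_threshold dS)) map_tnth_top.
Qed.

Lemma sigma_top k : sigma (top_tuple k) =1 id.
Proof.
move=> i; apply/val_inj; rewrite /= ffunE /= count_rev.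
transitivity (count (fun s => s < i)%N (iota 0 k)).
  by rewrite -val_enum_ord count_map.
have ik : (i <= k)%N by rewrite -ltnS.
rewrite -size_filter; have := filter_iota_ltn 0 ik.
by rewrite add0n => ->; rewrite size_iota.
Qed.

(** S consists of the last points sent to j or below, for j < k. *)
Lemma surjection_sigma m k (a : delta m k) :
  (forall i, exists j, a j = i) ->
  exists2 S : k.-tuple 'I_m, decreasing S & a = sigma S.
Proof.
move=> a_surj.
have [s a_s] : exists s : 'I_k -> 'I_m,
    forall j (i : 'I_m.+1), (i <= s j)%N = (a i <= j)%N.
  apply: (@fin_all_exists 'I_k (fun=> 'I_m)
    (fun j p => forall i : 'I_m.+1, (i <= p)%N = (a i <= j)%N)) => j.
  have [i0 ai0] := a_surj (lift ord0 j).
  have Pi0 : (j < a i0)%N by rewrite ai0 /= /bump add1n.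
  pose P i := (j < a i)%N.
  case: (@arg_minnP _ i0 P val Pi0) => p jp p_min.
  (* p is the first point sent above j. Since 0 is attained, a 0 = 0, so p has a predecessor, which
     is the required s j. *)
  have p_gt0 : (0 < p)%N.
    rewrite lt0n; apply: contraTneq jp => p0; rewrite /P -leqNgt.
    have [i ai] := a_surj ord0.
    have : (a p <= a i)%N by apply: delta_mono; rewrite p0.
    by rewrite ai leqn0 => /eqP ->.
  have p_lt : (p.-1 < m)%N by rewrite -ltnS prednK.
  exists (Ordinal p_lt) => i /=; apply/idP/idP => [ip|aij].
    rewrite leqNgt; apply/negP => /p_min /=.
    by rewrite leqNgt -[p : nat]prednK // ltnS ip.
  rewrite -ltnS prednK // ltnNge; apply/negP => pi.
  by have := leq_trans (delta_mono a pi) aij; rewrite leqNgt; case/negP.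
(* For i < j, a point over j lies after s i and not after s j. *)
have s_mono : {homo s : i j / (i < j)%N}.
  move=> i j ij; have [l al] := a_surj (widen_ord (leqnSn k) j).
  have lj : (l <= s j)%N by rewrite a_s al.
  by apply: leq_trans lj; rewrite ltnNge a_s al -ltnNge.
have dS := decreasing_map s_mono (decreasing_top k).
exists (map_tuple s (top_tuple k)) => //.
apply: deltaP => i; apply/val_inj/eqP.
(* Values in [k] are determined by their comparisons with all j < k. *)
have E (j : 'I_k) : (a i <= j)%N = (sigma (map_tuple s (top_tuple k)) i <= j)%N.
  rewrite -sigma_threshold // -a_s; congr (_ <= val _)%N.
  transitivity (tnth (map_tuple s (ord_tuple k)) j); last first.
    by congr tnth; apply: val_inj; rewrite /= map_rev revK.
  by rewrite tnth_map tnth_ord_tuple.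
move: (a i) (sigma _ i) E => x y E; rewrite eqn_leq; apply/andP; split.
  have [yk|ky] := ltnP y k; first by have := E (Ordinal yk); rewrite /= leqnn.
  by apply: leq_trans ky; have := ltn_ord x; rewrite ltnS.
have [xk|kx] := ltnP x k.
  by have := E (Ordinal xk); rewrite /= leqnn => <-.
by apply: leq_trans kx; have := ltn_ord y; rewrite ltnS.
Qed.

(** * The normalized chains of K A *)

Section DirectSumMaps.
Variables (n : nat) (F : nat -> zmodType).

Fact dput_is_additive i : zmod_morphism (@dput n F i).
Proof.
move=> x y; apply: functional_extensionality_dep => j.
rewrite -[RHS]/(@dput n F i x j - @dput n F i y j) -!dget_ord.
have [e|ne] := eqVneq i j; last by rewrite !dget_put_neq // subr0.
by rewrite -e !dget_put_eq // e -ltnS.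
Qed.
HB.instance Definition _ i :=
  GRing.isZmodMorphism.Build (F i) (dsum n F) (@dput n F i)
    (@dput_is_additive i).

Lemma dput_out i (a : F i) : (n < i)%N -> @dput n F i a = 0.
Proof.
move=> ni; apply: functional_extensionality_dep => j.
by rewrite -dget_ord dget_put_neq // gtn_eqF // (leq_trans _ ni).
Qed.

Lemma dsum_sum (z : dsum n F) : z = \sum_(i < n.+1) @dput n F i (dget i z).
Proof.
apply: functional_extensionality_dep => j; rewrite -!dget_ord raddf_sum.
rewrite (bigD1 j) //= dget_put_eq -1?ltnS // big1 ?addr0 // => i ij.
by rewrite dget_put_neq.
Qed.
End DirectSumMaps.

Section KPure.
Variable A : chain_complex.

Lemma K_pure_out n k (x : A k) phi : (n < k)%N -> @K_pure A n k x phi = 0.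
Proof. exact: dput_out. Qed.

Lemma K_ext n (V : zmodType) (f g : {additive K_ob A n -> V}) :
    (forall k (S : k.-tuple 'I_n) (x : A k), decreasing S ->
      f (K_pure x (wedge_tuple (@Zpsi n) S)) =
      g (K_pure x (wedge_tuple (@Zpsi n) S))) ->
  f =1 g.
Proof.
move=> fg z; rewrite [z]dsum_sum !raddf_sum; apply: eq_bigr => k _.
rewrite [dget k z](tensor_expand _ (@psi_dualE n) (@psi_dual_sum n)).
by rewrite !raddf_sum; apply: eq_bigr => S dS; apply: fg.
Qed.

(** delta_a evaluates at the vector of the last vertex's image, here v_n = 0; K(a) then has no
    differential term. *)
Lemma Ldelta_deg_max m n (a : {ffun 'I_m.+1 -> 'I_n.+1}) i phi :
  a ord_max = ord_max -> Ldelta_deg a i phi = 0.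
Proof.
move=> a_max; apply: val_inj; apply: ederiv0 => f.
rewrite /= /Zeval_fun a_max Zvec_max; exact: (raddf0 (f : {additive _ -> _})).
Qed.

Lemma K_map_pure_max m n (a : {ffun 'I_m.+1 -> 'I_n.+1}) k (x : A k) phi :
    (k <= n)%N -> a ord_max = ord_max ->
  K_map A a (K_pure x phi) = K_pure x (Lmap_deg a k phi).
Proof.
case: k x phi => [|k] x phi kn a_max; first exact: K_map_pure0.
by rewrite K_map_pureS // Ldelta_deg_max // /K_pure raddf0 raddf0 addr0.
Qed.

Lemma K_map_sigma n k (S : k.-tuple 'I_n) (x : A k) : decreasing S ->
  K_map A (sigma S) (K_pure x (omega k)) = K_pure x (wedge_tuple (@Zpsi n) S).
Proof. by move=> dS; rewrite K_map_pure_max ?sigma_max ?sigma_omega. Qed.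

Lemma coface_max n (i : 'I_n.+2) : (i < n.+1)%N -> coface i ord_max = ord_max.
Proof. by move=> ltin; apply: val_inj; rewrite ffunE /= /bump -ltnS ltin. Qed.

(** Without a differential term the face stays in degree n+1, where K_n A has no summand. *)
Lemma K_face_omega n (i : 'I_n.+2) (x : A n.+1) : (i < n.+1)%N ->
  K_map A (coface i) (K_pure x (omega n.+1)) = 0.
Proof.
by move=> ltin; rewrite K_map_pure_max ?coface_max // K_pure_out.
Qed.

(** The last coface sends n to n, and psi_i(v_n) is 1 for i = n and 0 for i < n. So delta strips the
    leading psi_n, while the other psi_i pull back to psi_i. *)
Lemma Ldelta_deg_omega n :
  Ldelta_deg (coface (@ord_max n.+1)) n (omega n.+1) = omega n.
Proof.
have c_max : coface (@ord_max n.+1) ord_max = n :> nat.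
  by rewrite ffunE /= /bump leqNgt ltnS leqnn.
apply: val_inj; rewrite -[LHS]/(ederiv _ _ (wedge _ (val (top_tuple n.+1)))).
rewrite top_tupleS wedge_cons ederivM ederiv_gen [Zeval _ _]Zpsi_vec c_max.
rewrite leqnn mul1r [ederiv _ _ _]ederiv_wedge0 ?mulr0 ?addr0; last first.
  move=> _ /mapP[i _ ->]; rewrite [LHS]Zpsi_vec c_max /=.
  by rewrite leqNgt ltn_ord.
rewrite /wedge big_map rmorph_prod; apply: eq_bigr => i _.
rewrite emap_gen; congr egen; apply: Zdual_ext => j.
rewrite Zdual_map_vec !Zpsi_vec c_max ffunE /= /bump [(n.+1 <= _)%N]leqNgt.
by rewrite ltn_ord add0n [(n <= i)%N]leqNgt ltn_ord subr0.
Qed.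

Lemma K_face_max_omega n (x : A n.+1) :
  K_map A (coface ord_max) (K_pure x (omega n.+1)) =
  K_pure (cdiff A n x) (omega n).
Proof.
by rewrite K_map_pureS // K_pure_out // add0r Ldelta_deg_omega.
Qed.
End KPure.

Section NK.
Variable A : chain_complex.
Let KA := K_simplicial A.

Fact K_omega_normal n (x : A n) : K_pure x (omega n) \in @normal_pred KA n.
Proof.
case: n x => // n x; apply/forallP => i; apply/eqP.
by apply: K_face_omega; exact: (ltn_ord i).
Qed.

Definition NK_unit_fun n (x : A n) : N_complex KA n :=
  Subgroup (K_omega_normal x).

Fact NK_unit_is_additive n : zmod_morphism (@NK_unit_fun n).
Proof.
move=> x y; apply: val_inj; rewrite raddfB /= -raddfB; congr dput.
by apply: (addIr (tpure y (omega n))); rewrite -tpureDl !subrK.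
Qed.
HB.instance Definition _ n :=
  GRing.isZmodMorphism.Build (A n) (N_complex KA n) (@NK_unit_fun n)
    (@NK_unit_is_additive n).

Fact NK_unit_diff n :
  @NK_unit_fun n \o cdiff A n =1 cdiff (N_complex KA) n \o @NK_unit_fun n.+1.
Proof. by move=> x; apply: val_inj; rewrite /= -K_face_max_omega. Qed.

Definition NK_unit : chain_map A (N_complex KA) :=
  @ChainMap A (N_complex KA) (fun n => @NK_unit_fun n) NK_unit_diff.

Definition NK_counit_fun n (z : N_complex KA n) : A n :=
  tensor_coord (@psi_dual n) (top_tuple n) (dget n (\val z)).

Lemma NK_unitK n : cancel (@NK_unit_fun n) (@NK_counit_fun n).
Proof.
move=> x; rewrite /NK_counit_fun dget_put_eq //.
by rewrite (tensor_coord_wedge (@psi_dualE n)) ?eqxx //; apply: decreasing_top.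
Qed.

(** This coface keeps the last vertex and carries v_i to v_(lift j i), so it merely relabels phi
    coordinates: those at words avoiding j can be read off the j-th face. *)
Lemma tensor_coord_face n (j : 'I_n.+1) k (w : seq 'I_n)
    (z : K_term A n.+1 k) :
  tensor_coord (@phi_dual n) w
    (tmap idfun (Lmap_deg (coface (widen_ord (leqnSn n.+1) j)) k) z) =
  tensor_coord (@phi_dual n.+1) (map (lift j) w) z.
Proof.
set a := coface _.
have a_max : a ord_max = ord_max by apply: coface_max => /=.
move: z; apply: (tensor_ext (f := tensor_coord _ w \o tmap _ _)) => x y.
rewrite -[LHS]/(tensor_coord _ w (tmap _ _ _)) tmap_pure !tensor_coord_pure.
congr (_ *~ _); rewrite [LHS]contractions_emap -map_comp /coord -map_comp.
apply: (congr1 (fun u => contractions u (\val y))).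
apply: eq_map => i; apply: additiveP => f /=.
rewrite [LHS]Zdual_map_vec a_max Zvec_max.
rewrite [X in _ - X](raddf0 (f : {additive _ -> _})) subr0.
by congr (homZ_fun f (Zvec _)); apply: val_inj; rewrite ffunE.
Qed.

(** A word of length k < n misses some j < n, so its coefficient is one of the j-th face, which
    vanishes. *)
Lemma normal_K_deg n (z : K_ob A n) k : z \in @normal_pred KA n -> (k < n)%N ->
  dget k z = 0.
Proof.
case: n z => // n z /normalP z0 kn.
rewrite [LHS](tensor_expand _ (@phi_dualE n.+1) (@phi_dual_sum n.+1)).
apply: big1 => S _.
have [j jS] : exists j, j \notin S.
  apply/existsP; rewrite -negb_forall; apply: contraL kn => /forallP allS.
  rewrite -leqNgt -(size_tuple S) -[X in (X <= _)%N]card_ord.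
  by apply: leq_trans (card_size S); apply/subset_leq_card/subsetP.
have [w ->] : exists w, tval S = map (lift j) w.
  rewrite memtE in jS; elim: (tval S) jS => [|i s IH]; first by exists [::].
  rewrite inE negb_or => /andP[/unlift_some[l -> _] /IH[w ->]].
  by exists (l :: w).
rewrite -tensor_coord_face.
have := z0 (widen_ord (leqnSn n.+1) j) (ltn_ord j).
move/(congr1 (dget k)); rewrite [in LHS]dget_K_map raddf0.
have -> : tmap (cdiff A k)
    (Ldelta_deg (coface (widen_ord (leqnSn n.+1) j)) k) =1 (fun=> 0).
  apply: (tensor_ext (g := \0)) => x y; rewrite tmap_pure Ldelta_deg_max.
    by rewrite raddf0.
  by apply: coface_max; exact: (ltn_ord j).
by rewrite addr0 => ->; rewrite raddf0 tpure0l.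
Qed.

(** Only degree n survives, and there the single decreasing n-tuple is the one of omega_n. *)
Lemma NK_counitK n : cancel (@NK_counit_fun n) (@NK_unit_fun n).
Proof.
move=> z; apply: val_inj; apply: functional_extensionality_dep => i.
rewrite -!dget_ord; have [i_n|n_i] := ltnP i n.
  rewrite [RHS](normal_K_deg (subgroup_valP z)) //.
  by rewrite dget_put_neq // gtn_eqF.
have -> : i = n :> nat by apply/eqP; rewrite eqn_leq n_i -ltnS ltn_ord.
rewrite dget_put_eq // [RHS](tensor_expand _ (@psi_dualE n) (@psi_dual_sum n)).
rewrite (bigD1 (top_tuple n)) ?decreasing_top //= big1 ?addr0 // => S.
by case/andP=> /decreasing_top_unique ->; rewrite eqxx.
Qed.
End NK.

(** * The counit K N X -> X *)

Lemma coface_factor m k (b : delta m k.+1) (i : 'I_k.+2) :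
  (forall j, b j != i) -> exists c : delta m k, b = delta_comp (coface i) c.
Proof.
move=> b_i.
have [c bc] : exists c : 'I_m.+1 -> 'I_k.+1, forall j, b j = lift i (c j).
  apply: (@fin_all_exists _ (fun=> 'I_k.+1) (fun j l => b j = lift i l)) => j.
  have := b_i j; rewrite eq_sym => /unlift_some[l bl _].
  by exists l.
have c_mono : {homo [ffun j => c j] : j l / (j <= l)%N}.
  by move=> j l /(delta_mono b); rewrite !ffunE !bc /= leq_bump2.
by exists (Delta c_mono); apply: deltaP => j; rewrite bc !ffunE.
Qed.

Section Counit.
Variable X : simplicial_ab.
Let NX := N_complex X.

Definition KN_counit_fun n (z : K_ob NX n) : X n :=
  \sum_(k < n.+1) \sum_(S : k.-tuple 'I_n | decreasing S)
    smap X (sigma S) (\val (tensor_coord (@psi_dual n) S (dget k z))).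

Fact KN_counit_is_additive n : zmod_morphism (@KN_counit_fun n).
Proof.
move=> x y; rewrite /KN_counit_fun -sumrB; apply: eq_bigr => k _.
by rewrite -sumrB; apply: eq_bigr => S _; rewrite !raddfB.
Qed.
HB.instance Definition _ n :=
  GRing.isZmodMorphism.Build (K_ob NX n) (X n) (@KN_counit_fun n)
    (@KN_counit_is_additive n).

Lemma KN_counit_wedge n k (S : k.-tuple 'I_n) (x : NX k) : decreasing S ->
  KN_counit_fun (K_pure x (wedge_tuple (@Zpsi n) S)) =
  smap X (sigma S) (\val x).
Proof.
move=> dS; have kn : (k <= n)%N.
  by have := decreasing_size dS; rewrite size_tuple.
rewrite /KN_counit_fun (bigD1 (Ordinal (kn : (k < n.+1)%N))) //=.
rewrite [X in _ + X]big1 => [|l lk]; last first.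
  apply: big1 => T _; rewrite dget_put_neq ?raddf0 //.
  by rewrite eq_sym; move: lk; rewrite -val_eqE.
rewrite addr0 (bigD1 S) //= dget_put_eq //.
rewrite (tensor_coord_wedge (@psi_dualE n)) // eqxx big1 ?addr0 // => T.
case/andP=> dT /negPf TS.
by rewrite (tensor_coord_wedge (@psi_dualE n)) // TS !raddf0.
Qed.

Lemma KN_counit_omega k (x : NX k) :
  KN_counit_fun (K_pure x (omega k)) = \val x.
Proof.
rewrite KN_counit_wedge ?decreasing_top // -[RHS](smap_id (s := X)).
by congr (smap X _ _); apply: deltaP => i; rewrite sigma_top ffunE.
Qed.

(* A map missing some i < k kills both sides; one missing only k factors      *)
(* through the last coface, which acts on x (x) omega_k as the differential.  *)
Lemma KN_counit_map_omega m k (b : delta m k) (x : NX k) :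
  KN_counit_fun (K_map NX b (K_pure x (omega k))) = smap X b (\val x).
Proof.
have surj_case l (c : delta m l) (y : NX l) :
    (forall i, exists j, c j = i) ->
    KN_counit_fun (K_map NX c (K_pure y (omega l))) = smap X c (\val y).
  case/surjection_sigma => S dS ->.
  by rewrite K_map_sigma // KN_counit_wedge.
case: k b x => [|k] b x.
  by apply: surj_case => i; exists ord0; rewrite !ord1.
have [[i [ik b_i]]|b_surj] := pselect (exists i : 'I_k.+2,
    (i < k.+1)%N /\ forall j, b j != i).
  have [c ->] := coface_factor b_i.
  rewrite K_smap_comp [X in KN_counit_fun X]/= [in LHS]K_face_omega // !raddf0.
  rewrite smap_comp /=.
  by rewrite [smap X (coface i) _](normalP (subgroup_valP x)) ?raddf0.
have b_hit (i : 'I_k.+2) : (i < k.+1)%N -> exists j, b j = i.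
  move=> ik; apply: contrapT => b_i; apply: b_surj; exists i; split=> // j.
  by apply/eqP => bj; apply: b_i; exists j.
have [[j bj]|b_max] := pselect (exists j, b j = ord_max).
  apply: surj_case => i; have [/b_hit//|ki] := ltnP i k.+1.
  exists j; rewrite bj; apply/val_inj/eqP.
  by rewrite /= eqn_leq ki -ltnS ltn_ord.
have [j|c bc] := @coface_factor _ _ b ord_max.
  by apply/eqP => bj; apply: b_max; exists j.
rewrite bc K_smap_comp [X in KN_counit_fun X]/= K_face_max_omega.
rewrite smap_comp surj_case // => i.
have [j bj] := b_hit (widen_ord (leqnSn k.+1) i) (ltn_ord i).
exists j; apply/val_inj; move: bj; rewrite bc !ffunE => /(congr1 val) /=.
by rewrite /bump leqNgt ltn_ord.
Qed.

(** As psi_S is omega_k pulled back along [sigma S], the claim reduces to [KN_counit_map_omega] for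
    the composite of [sigma S] and a. *)
Fact KN_counit_natural m n (a : delta m n) :
  @KN_counit_fun m \o K_map NX a =1 smap X a \o @KN_counit_fun n.
Proof.
apply: (K_ext (f := @KN_counit_fun m \o K_map NX a)
              (g := smap X a \o @KN_counit_fun n)) => k S x dS.
rewrite -[LHS]/(KN_counit_fun (K_map NX a _)).
rewrite -[RHS]/(smap X a (KN_counit_fun _)) KN_counit_wedge // -K_map_sigma //.
rewrite -[K_map NX a _](@K_smap_comp NX _ _ _ (sigma S) a) KN_counit_map_omega.
exact: smap_comp.
Qed.

Definition KN_counit : simplicial_map (K_simplicial NX) X :=
  @SimplicialMap (K_simplicial NX) X (fun n => @KN_counit_fun n)
    KN_counit_natural.

(** The first triangle identity; [KN_counit_K] is the second. *)
Lemma N_KN_counit n : N_map KN_counit n \o NK_unit NX n =1 id.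
Proof. by move=> x; apply: val_inj; apply: KN_counit_omega. Qed.
End Counit.

Lemma K_mor_pure (A B : chain_complex) (f : chain_map A B) n k (x : A k) phi :
  K_mor f n (K_pure x phi) = K_pure (f k x) phi.
Proof.
apply: functional_extensionality_dep => j; rewrite -!dget_ord dget_K_mor.
have [e|ne] := eqVneq k j; last by rewrite !dget_put_neq // raddf0.
by rewrite -e !dget_put_eq ?tmap_pure // e -ltnS.
Qed.

Lemma KN_counit_K (A : chain_complex) n :
  KN_counit (K_simplicial A) n \o K_mor (NK_unit A) n =1 id.
Proof.
apply: (K_ext (f := KN_counit _ n \o K_mor (NK_unit A) n) (g := idfun)).
move=> k S x dS; rewrite -[LHS]/(KN_counit_fun (K_mor (NK_unit A) n _)).
by rewrite K_mor_pure KN_counit_wedge // [LHS]K_map_sigma.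
Qed.

Lemma KN_counit_nat (X Y : simplicial_ab) (f : simplicial_map X Y) n :
  KN_counit Y n \o K_mor (N_map f) n =1 f n \o KN_counit X n.
Proof.
apply: (K_ext (f := KN_counit Y n \o K_mor (N_map f) n)
              (g := f n \o KN_counit X n)) => k S x dS.
rewrite -[LHS]/(KN_counit_fun (K_mor (N_map f) n _)).
rewrite -[RHS]/(f n (KN_counit_fun _)) K_mor_pure !KN_counit_wedge //.
exact/esym/(smor_natural f).
Qed.

(** * Normalization reflects isomorphisms *)

Section NormalizationConservative.
Variables (X Y : simplicial_ab) (f : simplicial_map X Y).

Lemma normal0P n (x : X n.+1) :
  (forall i : 'I_n.+2, face X i x = 0) -> x \in @normal_pred X n.+1.
Proof. by move=> x0; apply/forallP => i; apply/eqP. Qed.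

(** The faces of an element of the kernel lie in the kernel one dimension lower, so they vanish by
    induction and the element is normalized. *)
Lemma N_map_inj :
    (forall n x, x \in @normal_pred X n -> f n x = 0 -> x = 0) ->
  forall n x, f n x = 0 -> x = 0.
Proof.
move=> f_inj; elim=> [|n IH] x fx0; apply: f_inj => //.
apply: normal0P => i; apply: IH; rewrite [LHS](smor_natural f).
by rewrite /= fx0 raddf0.
Qed.

Section Skip.
Variables (n : nat) (j : 'I_n.+1).

Fact skip_subproof : {homo [ffun l : 'I_n.+2 =>
    if l == j :> nat then inord j.+1 else l] : l l' / (l <= l')%N}.
Proof.
have jn : (j.+1 < n.+2)%N by rewrite ltnS.
move=> l l' ll'; rewrite !ffunE.
case: eqP => [lj|_]; case: eqP => [l'j|l'j]; rewrite ?inordK //.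
  rewrite -lj ltn_neqAle ll' andbT; apply/eqP => ll; apply: l'j; rewrite -ll.
  exact: lj.
rewrite -l'j; exact: leq_trans ll' (leqnSn _).
Qed.

(* d^j s^j, written without the codegeneracy s^j. *)
Definition skip : delta n.+1 n.+1 := Delta skip_subproof.

Lemma skipE (l : 'I_n.+2) : skip l = (if l == j :> nat then j.+1 else l) :> nat.
Proof. by rewrite ffunE; case: eqP => // lj; rewrite inordK // ltnS. Qed.

(** After [coface i] with i < j, [skip] still misses i, so the pullback of y factors through the
    i-th face of y. *)
Lemma skip_coface_lt (y : Y n.+1) (i : 'I_n.+2) :
  (i < j)%N -> face Y i y = 0 -> face Y i (smap Y skip y) = 0.
Proof.
move=> ij y0; rewrite /face -[LHS]/((smap Y _ \o smap Y _) y) -smap_comp.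
have [l|c ->] := @coface_factor _ _ (delta_comp skip (coface i)) i.
  rewrite -val_eqE /= ffunE [val _]skipE ffunE /= /bump.
  by apply/eqP; case: eqP => _; [lia | case: leqP; lia].
by rewrite smap_comp /= [smap Y (coface i) y]y0 raddf0.
Qed.

Lemma skip_coface_eq (y : Y n.+1) :
  let i := widen_ord (leqnSn n.+1) j in face Y i (smap Y skip y) = face Y i y.
Proof.
rewrite /face -[LHS]/((smap Y _ \o smap Y _) y) -smap_comp.
congr (smap Y _ y); apply: deltaP => l; apply: val_inj.
rewrite ffunE [LHS]skipE ffunE /= /bump.
by case: eqP => //; case: leqP; lia.
Qed.

Lemma skip_factor : exists c : delta n.+1 n,
  skip = delta_comp (coface (widen_ord (leqnSn n.+1) j)) c.
Proof.
apply: coface_factor => l; rewrite -val_eqE /= [val _]skipE.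
by apply/eqP; case: eqP => // _; lia.
Qed.
End Skip.

(** Correct y by values of f until its faces below the last vanish one after another; what remains
    is normalized. *)
Lemma N_map_surj :
    (forall n y, y \in @normal_pred Y n -> exists x, f n x = y) ->
  forall n y, exists x, f n x = y.
Proof.
move=> f_surj; elim=> [|n IH] y; first exact: f_surj.
suff /(_ n.+1)[//|x yx]: forall p, (p <= n.+1)%N -> exists x,
    forall i : 'I_n.+2, (i < p)%N -> face Y i (y - f n.+1 x) = 0.
  have [x0 fx0] : exists x0, f n.+1 x0 = y - f n.+1 x.
    apply: f_surj; apply/forallP => i; apply/eqP/yx; exact: (ltn_ord i).
  by exists (x0 + x); rewrite raddfD fx0 subrK.
elim=> [|p IHp] pn; first by exists 0.
have [x yx] := IHp (ltnW pn); pose j := Ordinal pn.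
(* For r = y - f x, the correction is the pullback of r along [skip j]. It factors through the j-th
   face of r, which f reaches by induction. Subtracting it kills that face and keeps the earlier
   ones 0. *)
have [c skip_c] := skip_factor j.
have [z fz] := IH (face Y (widen_ord (leqnSn n.+1) j) (y - f n.+1 x)).
have fcz : f n.+1 (smap X c z) = smap Y (skip j) (y - f n.+1 x).
  by rewrite skip_c smap_comp /= -[RHS]/(smap Y c (face Y _ _)) -fz;
     apply: (smor_natural f c).
exists (x + smap X c z) => i; rewrite [f n.+1 (x + _)]raddfD opprD addrA fcz.
move: (y - f n.+1 x) yx {fz fcz} => y1 y1x; rewrite raddfB.
rewrite ltnS leq_eqVlt.
case/predU1P=> [ip|ip]; last by rewrite skip_coface_lt ?y1x // subr0.
have -> : i = widen_ord (leqnSn n.+1) j by apply: val_inj.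
by rewrite skip_coface_eq subrr.
Qed.
End NormalizationConservative.

(** The normalized chains of K N X are the x (x) omega_m, and the counit sends these to x,
    bijectively onto the normalized chains of X. *)
Lemma KN_counit_bij (X : simplicial_ab) n : bijective (KN_counit X n).
Proof.
have NKx m (z : N_complex (K_simplicial (N_complex X)) m) :
    exists x, z = NK_unit (N_complex X) m x.
  by exists (NK_counit_fun z); rewrite [RHS]NK_counitK.
have inj0 m x : KN_counit X m x = 0 -> x = 0.
  apply: N_map_inj => {}m {}x xN x0.
  have [y xy] := NKx m (Subgroup xN); have /= := N_KN_counit y.
  move/(congr1 val); rewrite -[NK_unit_fun y]xy /= x0 => /esym y0.
  have := congr1 val xy; rewrite /= => ->.
  have -> : y = 0 by exact: (@val_inj _ _ (normal X m)).
  by rewrite [LHS]/K_pure tpure0l raddf0.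
have surj m y : exists x, KN_counit X m x = y.
  apply: N_map_surj => {}m {}y yN.
  exists (K_pure (Subgroup yN : N_complex X m) (omega m)).
  exact: KN_counit_omega.
have [g gK] := choice (surj n).
exists g => // x; apply/eqP; rewrite -subr_eq0; apply/eqP; apply: inj0.
by rewrite raddfB gK subrr.
Qed.

(** * Equivalences of categories *)

Section NatIso.
Variables C D : category.

Lemma fmap_iso (F : functor C D) (X Y : C) (f : hom X Y) :
  is_iso f -> is_iso (fmap F f).
Proof.
by case=> g [gf fg]; exists (fmap F g); rewrite -!fmap_comp gf fg !fmap_id.
Qed.

Lemma comp_iso (X Y Z : C) (f : hom Y Z) (g : hom X Y) :
  is_iso f -> is_iso g -> is_iso (mcomp f g).
Proof.
case=> f' [f'f ff'] [g' [g'g gg']]; exists (mcomp g' f'); split.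
  by rewrite -mcompA [mcomp f' _]mcompA f'f mcomp_idl.
by rewrite -mcompA [mcomp g _]mcompA gg' mcomp_idl.
Qed.

Lemma nat_iso_inverse (F G : functor C D) (eta : nat_trans F G) :
    is_nat_iso eta ->
  exists theta : nat_trans G F, forall X,
    mcomp (theta X) (eta X) = idm (F X) /\ mcomp (eta X) (theta X) = idm (G X).
Proof.
move=> eta_iso; pose g X := projT1 (cid (eta_iso X)).
have gP X : mcomp (g X) (eta X) = idm (F X) /\ mcomp (eta X) (g X) = idm (G X).
  exact: (projT2 (cid (eta_iso X))).
have g_nat X Y (f : hom X Y) : mcomp (g Y) (fmap G f) = mcomp (fmap F f) (g X).
  rewrite -[LHS]mcomp_idr -(gP X).2 mcompA -[mcomp (mcomp (g Y) _) _]mcompA.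
  by rewrite -nt_natural mcompA (gP Y).1 mcomp_idl.
by exists (NatTrans g_nat).
Qed.

End NatIso.

Section AdjointInverse.
Variables (C D : category) (F : functor C D) (G : functor D C).
Variables (counit : nat_trans (comp_functor G F) (id_functor C)).
Variables (unit : nat_trans (id_functor D) (comp_functor F G)).
Hypotheses (counit_iso : is_nat_iso counit) (unit_iso : is_nat_iso unit).
Hypothesis triangleF : forall X,
  mcomp (fmap F (counit X)) (unit (F X)) = idm (F X).
Hypothesis triangleG : forall Y,
  mcomp (counit (G Y)) (fmap G (unit Y)) = idm (G Y).

(** The data present G as left adjoint to F. Inverting unit and counit swaps their roles, and the
    new triangle composites are the inverses of the given ones. *)
Lemma adjoint_inverse_of_counit : adjoint_inverse F G.
Proof.
have [eta etaP] := nat_iso_inverse counit_iso.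
have [eps epsP] := nat_iso_inverse unit_iso.
exists eta, eps; split=> [X|X|X|Y].
- by exists (counit X); split; [apply: (etaP X).2 | apply: (etaP X).1].
- by exists (unit X); split; [apply: (epsP X).2 | apply: (epsP X).1].
- rewrite -[LHS]mcomp_idr -[in LHS](triangleF X) -mcompA.
  rewrite [mcomp (fmap F (eta X)) _]mcompA -fmap_comp (etaP X).1 fmap_id.
  by rewrite mcomp_idl (epsP (F X)).1.
rewrite -[LHS]mcomp_idr -[in LHS](triangleG Y) -mcompA.
rewrite [mcomp (eta (G Y)) _]mcompA (etaP (G Y)).1 mcomp_idl.
rewrite -[LHS](fmap_comp G) (epsP Y).1; exact: (fmap_id G Y).
Qed.
End AdjointInverse.

(** The isomorphism is K -> G F K -> G, the unit at K followed by G applied to F K = 1. *)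
Lemma adjoint_inverse_unique (C D : category) (F : functor C D)
    (K G : functor D C) :
    functor_iso (comp_functor F K) (id_functor D) -> adjoint_inverse F G ->
  functor_iso K G.
Proof.
case=> e e_iso [eta [_ [eta_iso _ _ _]]].
pose t Y : hom (K Y) (G Y) := mcomp (fmap G (e Y)) (eta (K Y)).
have t_nat X Y (f : hom X Y) : mcomp (t Y) (fmap K f) = mcomp (fmap G f) (t X).
  transitivity
      (mcomp (fmap G (mcomp (e Y) (fmap F (fmap K f)))) (eta (K X))).
    rewrite fmap_comp -!mcompA.
    exact: (congr1 (mcomp (fmap G (e Y))) (nt_natural eta (fmap K f))).
  by rewrite [mcomp (e Y) _](nt_natural e f) fmap_comp mcompA.
exists (NatTrans t_nat) => Y.
exact: (comp_iso (fmap_iso G (e_iso Y)) (eta_iso (K Y))).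
Qed.

(** * Levelwise bijections are isomorphisms *)

Lemma additive_inverse (U V : zmodType) (f : {additive U -> V}) :
  bijective f -> exists g : {additive V -> U}, cancel f g /\ cancel g f.
Proof.
case=> g fK gK.
pose gM := GRing.isZmodMorphism.Build _ _ g (can2_zmod_morphism fK gK).
by exists (HB.pack_for {additive V -> U} g gM).
Qed.

Lemma chain_map_iso (A B : chain_complex) (f : chain_map A B) :
  (forall n, bijective (f n)) -> @is_iso Ch A B f.
Proof.
move=> f_bij; pose g n := projT1 (cid (additive_inverse (f_bij n))).
have gP n : cancel (f n) (g n) /\ cancel (g n) (f n).
  exact: (projT2 (cid (additive_inverse (f_bij n)))).
have g_diff n : g n \o cdiff B n =1 cdiff A n \o g n.+1.
  move=> x /=; rewrite -{1}[x](gP n.+1).2 -[cdiff B n _](cmor_diff f) /=.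
  exact: (gP n).1.
exists (ChainMap g_diff); split; apply: chain_mapP => n x.
  exact: (gP n).1.
exact: (gP n).2.
Qed.

Lemma simplicial_map_iso (X Y : simplicial_ab) (f : simplicial_map X Y) :
  (forall n, bijective (f n)) -> @is_iso sAb X Y f.
Proof.
move=> f_bij; pose g n := projT1 (cid (additive_inverse (f_bij n))).
have gP n : cancel (f n) (g n) /\ cancel (g n) (f n).
  exact: (projT2 (cid (additive_inverse (f_bij n)))).
have g_nat m n (a : delta m n) : g m \o smap Y a =1 smap X a \o g n.
  move=> x /=; rewrite -{1}[x](gP n).2 -[smap Y a _](smor_natural f) /=.
  exact: (gP m).1.
exists (SimplicialMap g_nat); split; apply: simplicial_mapP => n x.
  exact: (gP n).1.
exact: (gP n).2.
Qed.

(** * The two natural isomorphisms and the theorem *)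

Fact KN_counit_nt_natural (X Y : sAb) (f : hom X Y) :
  mcomp (KN_counit Y : hom (Kfun (Nfun Y)) Y) (fmap Kfun (fmap Nfun f)) =
  mcomp f (KN_counit X).
Proof. by apply: simplicial_mapP => n; apply: KN_counit_nat. Qed.

Definition KN_counit_nt : nat_trans (comp_functor Kfun Nfun) (id_functor sAb) :=
  @NatTrans _ _ (comp_functor Kfun Nfun) (id_functor sAb) KN_counit
    KN_counit_nt_natural.

Lemma KN_counit_nt_iso : is_nat_iso KN_counit_nt.
Proof. by move=> X; apply: simplicial_map_iso => n; apply: KN_counit_bij. Qed.

Fact NK_unit_nt_natural (A B : Ch) (f : hom A B) :
  mcomp (NK_unit B : hom B (Nfun (Kfun B))) f =
  mcomp (fmap Nfun (fmap Kfun f)) (NK_unit A).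
Proof.
by apply: chain_mapP => n x; apply: val_inj; rewrite /= [RHS]K_mor_pure.
Qed.

Definition NK_unit_nt : nat_trans (id_functor Ch) (comp_functor Nfun Kfun) :=
  @NatTrans _ _ (id_functor Ch) (comp_functor Nfun Kfun) NK_unit
    NK_unit_nt_natural.

Lemma NK_unit_nt_iso : is_nat_iso NK_unit_nt.
Proof.
move=> A; apply: chain_map_iso => n.
exists (@NK_counit_fun A n); [exact: NK_unitK | exact: NK_counitK].
Qed.

Theorem proposition3 :
  functor_iso (comp_functor Kfun Nfun) (id_functor sAb) /\
  functor_iso (comp_functor Nfun Kfun) (id_functor Ch) /\
  (exists G : functor Ch sAb, adjoint_inverse Nfun G) /\
  (forall G : functor Ch sAb, adjoint_inverse Nfun G -> functor_iso Kfun G).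
Proof.
have NK_iso : functor_iso (comp_functor Nfun Kfun) (id_functor Ch).
  have [eps epsP] := nat_iso_inverse NK_unit_nt_iso.
  by exists eps => A; exists (NK_unit_nt A); have [] := epsP A.
split; first by exists KN_counit_nt; apply: KN_counit_nt_iso.
do ![split=> //]; last by move=> G; apply: adjoint_inverse_unique.
exists Kfun.
apply: adjoint_inverse_of_counit KN_counit_nt_iso NK_unit_nt_iso _ _.
  by move=> X; apply: chain_mapP => n; apply: N_KN_counit.
by move=> A; apply: simplicial_mapP => n; apply: KN_counit_K.
Qed.
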